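(* Let $\mathsf{MG}$ be the category whose objects are MAT-labeled graphs and whose morphisms are label-preserving homomorphisms, and let $\mathsf{LRV}$ be the category whose objects are LR-vines and whose morphisms are poset homomorphisms preserving rank and join. Let $\Psi\colon \mathsf{MG}\to\mathsf{LRV}$ be the functor sending an MAT-labeled graph $(G,\lambda)$ to the poset $\Psi(G,\lambda)$ (described in the context) and a morphism $\sigma\colon (G,\lambda)\to(G',\lambda')$ to the map $\Psi(\sigma)\colon v\mapsto \{\sigma(a)\mid a\in v\}$; let $\Omega\colon\mathsf{LRV}\to\mathsf{MG}$ be the functor sending an LR-vine $\mathcal{P}$ to the edge-labeled graph $\Omega(\mathcal{P})$ (described in the context) and a morphism $\varphi\colon\mathcal{P}\to\mathcal{P}'$ to the map $\Omega(\varphi)\colon i\mapsto\varphi(i)$ on minimal elements. Then the composite functor $\Psi\Omega$ is naturally isomorphic to the identity functor $1_{\mathsf{LRV}}$, and $\Omega\Psi$ is naturally isomorphic to the identity functor $1_{\mathsf{MG}}$. In particular, the categories $\mathsf{MG}$ and $\mathsf{LRV}$ are equivalent.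
   Context: Graphs are finite, simple and undirected. An edge-labeled graph $(G,\lambda)$ is a graph $G$ with a map $\lambda\colon E_G\to\mathbb{Z}_{>0}$; write $\lambda(u,v)=\lambda(\{u,v\})$, $\pi_k=\lambda^{-1}(k)$, $\pi_{<k}=\bigcup_{j<k}\pi_j$, $\pi_{\le k}=\bigcup_{j\le k}\pi_j$. For an edge $\{u,v\}\in\pi_k$, a conditioning vertex is a vertex $h$ with $\{u,h\},\{v,h\}\in E_G$ both of label $<k$. $\lambda$ is an MAT-labeling (and $(G,\lambda)$ an MAT-labeled graph) if for every $k\in\mathbb{Z}_{>0}$: (ML1) no edge $e\in\pi_{\le k}$ forms a cycle with edges in $\pi_k$; (ML2) every edge in $\pi_k$ has exactly $k-1$ conditioning vertices. For an edge $e=\{i,j\}\in\pi_k$ with conditioning vertices $h_1,\dots,h_{k-1}$, the principal clique generated by $e$ is $K_e=\{i,j,h_1,\dots,h_{k-1}\}$. A label-preserving homomorphism $\sigma\colon(G,\lambda)\to(G',\lambda')$ is a map $\sigma\colon N_G\to N_{G'}$ such that every edge $\{u,v\}\in E_G$ satisfies $\{\sigma(u),\sigma(v)\}\in E_{G'}$ and $\lambda'(\sigma(u),\sigma(v))=\lambda(u,v)$. Posets are finite. A poset $\mathcal{P}$ is graded with rank function $\operatorname{rk}\colon\mathcal{P}\to\mathbb{Z}_{>0}$ if $x<y$ implies $\operatorname{rk}(x)<\operatorname{rk}(y)$, $\operatorname{rk}(y)=\operatorname{rk}(x)+1$ whenever $y$ covers $x$, and all minimal elements have rank $1$. Let $\mathcal{P}_i$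 be the set of elements of rank $i$, $\operatorname{rk}(\mathcal{P})$ the maximal rank, $\dim(\mathcal{P})$ the number of minimal elements, and $\mathcal{E}(v)$ the set of elements covered by $v$. A vine is a finite graded poset such that (1) every non-minimal element covers exactly two elements, and any two distinct elements of the same rank are covered by at most one common element; (2) for each $1\le i\le\operatorname{rk}(\mathcal{P})$ the graph $F_i$ with vertex set $\mathcal{P}_i$ and edge set $\{\mathcal{E}(v)\mid v\in\mathcal{P}_{i+1}\}$ is a forest. A vine is an R-vine if $\operatorname{rk}(\mathcal{P})=\dim(\mathcal{P})$, each $F_i$ is a tree, and (proximity) any two distinct elements of the same rank $i\ge2$ that are covered by a common element cover a common element. A vine is an LR-vine if every principal ideal $\mathcal{P}_{\le v}=\{x\mid x\le v\}$ (with induced order and rank) is an R-vine. A homomorphism $\varphi$ of graded posets preserves rank if $\operatorname{rk}'(\varphi(x))=\operatorname{rk}(x)$, and preserves join if whenever the join $x\vee y$ exists, $\varphi(x)\vee\varphi(y)$ exists and equals $\varphi(x\vee y)$. $\Psi(G,\lambda)$: the poset whose elements are the singletons $\{i\}$, $i\in N_G$, and all principal cliques $K_e$, $e\in E_G$, ordered by inclusion, with rank equal to cardinality. $\Omega(\mathcal{P})$: the edge-labeled graph with vertex set the minimal elements of $\mathcal{P}$, with $\{i,j\}$ ($i\neq j$) an edge iff the join $i\vee j$ exists in $\mathcal{P}$, labeled $\lambda(i,j)=\operatorname{rk}(i\vee j)-1$. *)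

(* Defs.v *)
From HB Require Import structures.
From mathcomp Require Import all_boot all_order.

Set Implicit Arguments.
Unset Strict Implicit.
Unset Printing Implicit Defensive.

Import Order.TTheory.

Record category := Category {
  obj :> Type;
  hom : obj -> obj -> Type;
  idc : forall X, hom X X;
  comp : forall X Y Z, hom Y Z -> hom X Y -> hom X Z;
  comp_idl : forall X Y (f : hom X Y), comp (idc Y) f = f;
  comp_idr : forall X Y (f : hom X Y), comp f (idc X) = f;
  compA : forall X Y Z W (h : hom Z W) (g : hom Y Z) (f : hom X Y),
    comp h (comp g f) = comp (comp h g) f }.

Arguments idc {c} X.
Arguments comp {c X Y Z}.

Definition is_iso (C : category) (X Y : C) (f : hom X Y) : Prop :=
  exists g : hom Y X, comp g f = idc X /\ comp f g = idc Y.

(* The action on morphisms of a functor whose object map is [F]. *)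
Record functor_on (C D : category) (F : C -> D) := FunctorOn {
  fmap : forall X Y, hom X Y -> hom (F X) (F Y);
  fmap_id : forall X, fmap (idc X) = idc (F X);
  fmap_comp : forall X Y Z (g : hom Y Z) (f : hom X Y),
    fmap (comp g f) = comp (fmap g) (fmap f) }.

Arguments fmap {C D F} _ {X Y}.

Record functor (C D : category) := Functor {
  fobj :> C -> D;
  fmor :> functor_on fobj }.

Arguments Functor {C D fobj} fmor.

Definition functor_id (C : category) : functor C C :=
  Functor (@FunctorOn C C (fun X => X) (fun _ _ f => f)
             (fun _ => erefl) (fun _ _ _ _ _ => erefl)).

Section FunctorComp.
Variables (A B C : category) (G : functor B C) (F : functor A B).

Lemma functor_comp_id (X : A) : fmap G (fmap F (idc X)) = idc (G (F X)).
Proof. by rewrite !fmap_id. Qed.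

Lemma functor_comp_comp (X Y Z : A) (g : hom Y Z) (f : hom X Y) :
  fmap G (fmap F (comp g f)) = comp (fmap G (fmap F g)) (fmap G (fmap F f)).
Proof. by rewrite !fmap_comp. Qed.

Definition functor_comp : functor A C :=
  Functor (@FunctorOn A C (fun X => G (F X)) (fun X Y f => fmap G (fmap F f))
             functor_comp_id functor_comp_comp).
End FunctorComp.

Definition naturally_isomorphic (C D : category) (F G : functor C D) : Prop :=
  exists eta : forall X, hom (F X) (G X),
    (forall X Y (f : hom X Y),
       comp (eta Y) (fmap F f) = comp (fmap G f) (eta X))
    /\ forall X, is_iso (eta X).

Definition equivalent_categories (C D : category) : Prop :=
  exists (F : functor C D) (G : functor D C),
    naturally_isomorphic (functor_comp F G) (functor_id D)
    /\ naturally_isomorphic (functor_comp G F) (functor_id C).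

(* Graph on a vertex set [A] with edge set [F], a set of 2-element sets. *)
Section Graphs.
Variable T : finType.
Implicit Types (A : {set T}) (F : {set {set T}}) (c : seq T).

(* The seq [c] lists the vertices of a cycle in cyclic order. *)
Definition simple_cycle c : bool := (2 < size c) && uniq c.

Definition cycle_edges c : {set {set T}} := [set [set x; next c x] | x in c].

Definition forest F : Prop :=
  forall c, simple_cycle c -> ~~ (cycle_edges c \subset F).

Definition tree A F : Prop :=
  [/\ A != set0, forest F
    & {in A &, forall x y, connect [rel u v | [set u; v] \in F] x y}].

End Graphs.

(* The values of [label] outside of [edges] are irrelevant. *)
Record elgraph := ELGraph {
  vertex :> finType;
  edges : {set {set vertex}};
  label : {set vertex} -> nat;
  card_edge : forall e, e \in edges -> #|e| = 2;
  label_gt0 : forall e, e \in edges -> 0 < label e }.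

Section MATLabeling.
Variable G : elgraph.
Implicit Types (e : {set G}) (k : nat).

Definition edges_eq k : {set {set G}} := [set e in edges G | label e == k].
Definition edges_le k : {set {set G}} := [set e in edges G | label e <= k].

(* No u in e is a conditioning vertex of e: [set u; u] is not an edge. *)
Definition cond_vertices e : {set G} :=
  [set h | [forall u in e,
     ([set u; h] \in edges G) && (label [set u; h] < label e)]].

Definition ML1 k : Prop :=
  forall e, e \in edges_le k ->
  forall c : seq G, simple_cycle c -> e \in cycle_edges c ->
    ~~ (cycle_edges c :\ e \subset edges_eq k).

Definition ML2 k : Prop :=
  forall e, e \in edges_eq k -> #|cond_vertices e| = k.-1.

Definition MAT_labeling : Prop := forall k, 0 < k -> ML1 k /\ ML2 k.

Definition principal_clique e : {set G} := e :|: cond_vertices e.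

End MATLabeling.

Record MATgraph := MATGraph {
  MAT_graph :> elgraph;
  MATgraphP : MAT_labeling MAT_graph }.

Definition label_preserving (G G' : elgraph) (f : {ffun G -> G'}) : bool :=
  [forall u, forall v, ([set u; v] \in edges G) ==>
     ([set f u; f v] \in edges G')
     && (label [set f u; f v] == label [set u; v])].

Record lphom (G G' : elgraph) := LPHom {
  lpfun :> {ffun G -> G'};
  lphomP : label_preserving lpfun }.

HB.instance Definition _ (G G' : elgraph) := [isSub for @lpfun G G'].

Section MGCategory.

Lemma lphom_id_subproof (G : elgraph) : label_preserving [ffun x : G => x].
Proof. by apply/'forall_forallP => u v; rewrite !ffunE eqxx andbT implybb. Qed.

Definition lphom_id (G : elgraph) : lphom G G := LPHom (lphom_id_subproof G).

Lemma lphom_comp_subproof (G1 G2 G3 : elgraph)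
    (g : lphom G2 G3) (f : lphom G1 G2) :
  label_preserving [ffun x => g (f x)].
Proof.
apply/'forall_forallP => u v; apply/implyP => uvE; rewrite !ffunE.
have /'forall_forallP/(_ u v)/implyP/(_ uvE)/andP[fE /eqP <-] := lphomP f.
by have /'forall_forallP/(_ (f u) (f v))/implyP/(_ fE) := lphomP g.
Qed.

Definition lphom_comp (G1 G2 G3 : elgraph)
    (g : lphom G2 G3) (f : lphom G1 G2) : lphom G1 G3 :=
  LPHom (lphom_comp_subproof g f).

Lemma lphom_idl (G G' : elgraph) (f : lphom G G') :
  lphom_comp (lphom_id G') f = f.
Proof. by apply/val_inj/ffunP => x; rewrite !ffunE. Qed.

Lemma lphom_idr (G G' : elgraph) (f : lphom G G') :
  lphom_comp f (lphom_id G) = f.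
Proof. by apply/val_inj/ffunP => x; rewrite !ffunE. Qed.

Lemma lphom_compA (G1 G2 G3 G4 : elgraph)
    (h : lphom G3 G4) (g : lphom G2 G3) (f : lphom G1 G2) :
  lphom_comp h (lphom_comp g f) = lphom_comp (lphom_comp h g) f.
Proof. by apply/val_inj/ffunP => x; rewrite !ffunE. Qed.

Definition MG : category :=
  @Category MATgraph (fun G G' => lphom G G') (fun G => lphom_id G)
    (fun _ _ _ g f => lphom_comp g f)
    (fun _ _ f => lphom_idl f) (fun _ _ f => lphom_idr f)
    (fun _ _ _ _ h g f => lphom_compA h g f).

End MGCategory.

(* A finite poset with a candidate rank function; see [graded] below. *)
Record rposet := RPoset {
  rp_disp : Order.disp_t;
  rp_sort :> finPOrderType rp_disp;
  rk : rp_sort -> nat }.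

Arguments rk {r}.

Section Vine.
Variable P : rposet.
Implicit Types (x y z v : P) (A : {set P}).

Definition covers y x : bool :=
  (x < y)%O && [forall z, ~~ ((x < z)%O && (z < y)%O)].

Definition minimal x : bool := [forall y, ~~ (y < x)%O].

Definition graded : Prop :=
  [/\ forall x y, (x < y)%O -> rk x < rk y,
      forall x y, covers y x -> rk y = (rk x).+1
    & forall x, minimal x -> rk x = 1].

Definition rank_set i : {set P} := [set x | rk x == i].

Definition poset_rk : nat := \max_(x : P) rk x.
Definition poset_dim : nat := #|[set x : P | minimal x]|.

Definition covered v : {set P} := [set x | covers v x].

(* The edge set of the graph F_i, whose vertex set is [rank_set i]. *)
Definition level_edges i : {set {set P}} :=
  [set covered v | v in rank_set i.+1].

Definition vine : Prop :=
  [/\ graded,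
      forall v, ~~ minimal v -> #|covered v| = 2,
      forall x y v w, x != y -> rk x = rk y ->
        covers v x -> covers v y -> covers w x -> covers w y -> v = w
    & forall i, 1 <= i <= poset_rk -> forest (level_edges i)].

Definition proximity : Prop :=
  forall x y, x != y -> rk x = rk y -> 2 <= rk x ->
    (exists v, covers v x && covers v y) ->
    exists z, covers x z && covers y z.

Definition R_vine : Prop :=
  [/\ vine, poset_rk = poset_dim,
      forall i, 1 <= i <= poset_rk -> tree (rank_set i) (level_edges i)
    & proximity].

Definition is_sup A z : bool :=
  [forall x in A, (x <= z)%O]
  && [forall w, [forall x in A, (x <= w)%O] ==> (z <= w)%O].

Definition is_join x y z : bool := is_sup [set x; y] z.

End Vine.

Section Ideal.
Variables (P : rposet) (v : P).

Record ideal := Ideal { ideal_val : P; ideal_valP : (ideal_val <= v)%O }.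

HB.instance Definition _ := [isSub for ideal_val].
HB.instance Definition _ := [Finite of ideal by <:].
HB.instance Definition _ :=
  [SubChoice_isSubPOrder of ideal by <: with rp_disp P].

Definition principal_ideal : rposet :=
  @RPoset (rp_disp P) ideal (fun x => rk (ideal_val x)).

End Ideal.

Definition LR_vine (P : rposet) : Prop :=
  vine P /\ forall v : P, R_vine (principal_ideal v).

Record LRvine := LRVine {
  LR_poset :> rposet;
  LRvineP : LR_vine LR_poset }.

Section RJHom.
Variables P P' : rposet.

Definition rank_join_preserving (f : {ffun P -> P'}) : bool :=
  [&& [forall x, forall y, (x <= y)%O ==> (f x <= f y)%O],
      [forall x, rk (f x) == rk x]
    & [forall x, forall y, forall z,
         is_join x y z ==> is_join (f x) (f y) (f z)]].

Record rjhom := RJHom {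
  rjfun :> {ffun P -> P'};
  rjhomP : rank_join_preserving rjfun }.

HB.instance Definition _ := [isSub for rjfun].

Lemma rank_join_preservingP (f : {ffun P -> P'}) :
  reflect [/\ forall x y, (x <= y)%O -> (f x <= f y)%O,
              forall x, rk (f x) = rk x
            & forall x y z, is_join x y z -> is_join (f x) (f y) (f z)]
          (rank_join_preserving f).
Proof.
apply: (iffP and3P) => [[fle frk fj]|[fle frk fj]]; split.
- by move=> x y; apply/implyP; move/'forall_forallP: fle; apply.
- by move=> x; apply/eqP; move/forallP: frk; apply.
- move=> x y z; apply/implyP.
  by move/'forall_forallP: fj => /(_ x y)/forallP; apply.
- by apply/'forall_forallP => x y; apply/implyP/fle.
- by apply/forallP => x; rewrite frk.
- by apply/'forall_forallP => x y; apply/forallP => z; apply/implyP/fj.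
Qed.

End RJHom.

Section LRVCategory.

Lemma rjhom_id_subproof (P : rposet) : rank_join_preserving [ffun x : P => x].
Proof. by apply/rank_join_preservingP; split=> *; rewrite !ffunE. Qed.

Definition rjhom_id (P : rposet) : rjhom P P := RJHom (rjhom_id_subproof P).

Lemma rjhom_comp_subproof (P1 P2 P3 : rposet)
    (g : rjhom P2 P3) (f : rjhom P1 P2) :
  rank_join_preserving [ffun x => g (f x)].
Proof.
have /rank_join_preservingP[fle frk fj] := rjhomP f.
have /rank_join_preservingP[gle grk gj] := rjhomP g.
apply/rank_join_preservingP; split=> [x y|x|x y z]; rewrite !ffunE.
- by move/fle/gle.
- by rewrite grk frk.
- by move/fj/gj.
Qed.

Definition rjhom_comp (P1 P2 P3 : rposet)
    (g : rjhom P2 P3) (f : rjhom P1 P2) : rjhom P1 P3 :=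
  RJHom (rjhom_comp_subproof g f).

Lemma rjhom_idl (P P' : rposet) (f : rjhom P P') :
  rjhom_comp (rjhom_id P') f = f.
Proof. by apply/val_inj/ffunP => x; rewrite !ffunE. Qed.

Lemma rjhom_idr (P P' : rposet) (f : rjhom P P') :
  rjhom_comp f (rjhom_id P) = f.
Proof. by apply/val_inj/ffunP => x; rewrite !ffunE. Qed.

Lemma rjhom_compA (P1 P2 P3 P4 : rposet)
    (h : rjhom P3 P4) (g : rjhom P2 P3) (f : rjhom P1 P2) :
  rjhom_comp h (rjhom_comp g f) = rjhom_comp (rjhom_comp h g) f.
Proof. by apply/val_inj/ffunP => x; rewrite !ffunE. Qed.

Definition LRV : category :=
  @Category LRvine (fun P P' => rjhom P P') (fun P => rjhom_id P)
    (fun _ _ _ g f => rjhom_comp g f)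
    (fun _ _ f => rjhom_idl f) (fun _ _ f => rjhom_idr f)
    (fun _ _ _ _ h g f => rjhom_compA h g f).

End LRVCategory.

Fact psi_display : Order.disp_t.
Proof. exact. Qed.

Section PsiPoset.
Variable G : elgraph.

Definition psi_pred (v : {set G}) : bool :=
  (v \in [set [set i] | i in [set: G]])
  || (v \in [set principal_clique e | e in edges G]).

Record psi_elt := PsiElt { psi_val : {set G}; psi_valP : psi_pred psi_val }.

HB.instance Definition _ := [isSub for psi_val].
HB.instance Definition _ := [Finite of psi_elt by <:].

Definition psi_le (v w : psi_elt) : bool := psi_val v \subset psi_val w.

Lemma psi_le_refl : reflexive psi_le.
Proof. by move=> v; apply: subxx. Qed.

Lemma psi_le_anti : antisymmetric psi_le.
Proof. by move=> v w vw; apply/val_inj/eqP; rewrite eqEsubset. Qed.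

Lemma psi_le_trans : transitive psi_le.
Proof. by move=> v u w; apply: subset_trans. Qed.

HB.instance Definition _ :=
  Order.Le_isPOrder.Build psi_display psi_elt
    psi_le_refl psi_le_anti psi_le_trans.

Definition psi_poset : rposet :=
  @RPoset psi_display psi_elt (fun v => #|psi_val v|).

End PsiPoset.

Section OmegaGraph.
Variable P : rposet.

Record min_elt := MinElt { min_val : P; min_valP : minimal min_val }.

HB.instance Definition _ := [isSub for min_val].
HB.instance Definition _ := [Finite of min_elt by <:].

Definition sup_of (e : {set min_elt}) (z : P) : bool := is_sup (min_val @: e) z.

Definition omega_edges : {set {set min_elt}} :=
  [set e : {set min_elt} | (#|e| == 2) && [exists z, sup_of e z]].

(* By antisymmetry the supremum picked here is unique. *)
Definition omega_label (e : {set min_elt}) : nat :=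
  if [pick z | sup_of e z] is Some z then (rk z).-1 else 0.

Lemma omega_card_edge e : e \in omega_edges -> #|e| = 2.
Proof. by rewrite inE => /andP[/eqP]. Qed.

Hypothesis grP : graded P.

Lemma omega_label_gt0 e : e \in omega_edges -> 0 < omega_label e.
Proof.
rewrite inE /omega_label => /andP[/cards2P[i [j [ij ->]]] /existsP[z0 z0P]].
case: pickP => [z /andP[/forall_inP ub _]|/(_ z0)]; last by rewrite z0P.
have [rk_lt _ rk_min] := grP.
have iz : (min_val i <= z)%O by apply/ub/imset_f; rewrite !inE eqxx.
have jz : (min_val j <= z)%O by apply/ub/imset_f; rewrite !inE eqxx orbT.
move: iz; rewrite le_eqVlt => /predU1P[iz|/rk_lt]; last first.
  by rewrite (rk_min _ (min_valP i)) -ltn_predRL.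
move: jz; rewrite -iz le_eqVlt => /predU1P[/val_inj ji|ji].
  by rewrite ji eqxx in ij.
by have /forallP/(_ (min_val j)) := min_valP i; rewrite ji.
Qed.

Definition omega_graph : elgraph :=
  @ELGraph min_elt omega_edges omega_label omega_card_edge omega_label_gt0.

End OmegaGraph.

Lemma LRvine_graded (P : LRvine) : graded P.
Proof. by case: (LRvineP P) => -[]. Qed.

(* Main.v *)
(* An LR-vine is recovered from the sets of minimal elements lying below its
   elements, so that vines become families of finite sets ordered by inclusion
   in which every set of size r > 1 is the union of the two sets of size r - 1
   that it covers. The forest conditions make such a family closed under
   nonempty intersections, and imply that in every cycle of sets of equal size
   whose consecutive members are bounded, some bound of consecutive members
   contains a further member of the cycle: otherwise one could lift the cycle
   to one of sets of size r + 1 with the same bounds, forever. Applied to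
   singletons, this gives both conditions of an MAT-labeling for the graph of
   joins. Conversely, the principal cliques of an MAT-labeled graph are shown to
   form such a family by induction on the labels: for an edge {i, j} of label k
   with conditioning vertices H, the 4-cycles i, h, j, h' force H to be bounded
   in the family of cliques of smaller labels, so that H + i and H + j are
   cliques of size k, and these are the two elements covered by H + i + j. A
   cycle in the forest of rank k would have a common intersection H, and hence
   yield a cycle of edges of label k. *)

Require Import Defs.
From mathcomp Require Import all_boot all_order.
From mathcomp Require Import zify.

Set Implicit Arguments.
Unset Strict Implicit.
Unset Printing Implicit Defensive.

Import Order.TTheory.

(* [zify] is very slow on hypotheses about sets. *)
Ltac nlia := repeat match goal with
  | H : forall _, _ |- _ => clear H
  | H : is_true (_ \in _) |- _ => clear H
  | H : is_true (_ \subset _) |- _ => clear H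
  | H : is_true (_ \proper _) |- _ => clear H
  | H : _ \/ _ |- _ => clear H
  end; lia.

(** * Forests *)

Section Forests.
Variable T : finType.
Implicit Types (F : {set {set T}}) (c p : seq T) (x y z : T).

Definition adj F : rel T := [rel x y | [set x; y] \in F].

Lemma adj_sym F : symmetric (adj F).
Proof. by move=> x y; rewrite /adj /= setUC. Qed.

Lemma adj_connect_sym F : connect_sym (adj F).
Proof. exact/sym_connect_sym/adj_sym. Qed.

Lemma connect_adjS F F' : F \subset F' ->
  subrel (connect (adj F)) (connect (adj F')).
Proof.
by move=> /subsetP sFF'; apply: connect_sub => x y /sFF'; apply: connect1.
Qed.

Lemma path_avoid F (e : {set T}) x y p :
  path (adj F) y p -> x \notin y :: p -> x \in e -> path (adj (F :\ e)) y p.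
Proof.
elim: p y => //= z p IH y /andP[yz zp]; rewrite inE negb_or => /andP[xy xzp] xe.
rewrite IH // andbT /adj /= in_setD1 (yz : [set y; z] \in F) andbT; apply: contraTneq xe => <-.
by rewrite !inE negb_or xy; case/norP: xzp.
Qed.

Lemma cycle_edges_sub F c :
  uniq c -> (cycle_edges c \subset F) = cycle (adj F) c.
Proof.
move=> Uc; apply/subsetP/idP => [sF|cycF e /imsetP[x xc ->]].
  by apply: cycle_from_next => // x xc; apply/sF/imset_f.
exact: next_cycle cycF xc.
Qed.

Lemma next_neq c x : simple_cycle c -> x \in c -> next c x != x.
Proof.
case/andP=> + Uc xc; case/rot_to: (xc) => i p rotc.
rewrite -(size_rot i) -(next_rot i Uc) rotc; move: Uc.
by rewrite -(rot_uniq i) rotc; case: p {rotc} => [|y []] //= z p;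
  rewrite !inE eqxx eq_sym => /andP[] + _ _; case: eqP.
Qed.

Lemma next_neq_prev c x : simple_cycle c -> x \in c -> next c x != prev c x.
Proof.
case/andP=> + Uc xc; suff: 2 < size c -> next c (next c x) != x.
  by move=> neq /neq; apply: contra => /eqP->; rewrite next_prev.
case/rot_to: xc => i p rotc; rewrite -(size_rot i) -!(next_rot i Uc) rotc.
move: Uc; rewrite -(rot_uniq i) rotc; case: p {rotc} => [|y [|z p]] //=.
rewrite !inE !negb_or eqxx => /andP[/and3P[xy xz _] _] _.
by rewrite (eq_sym y x) (negPf xy) eqxx eq_sym.
Qed.

Lemma forest_bridge F x y : forest F -> x != y -> [set x; y] \in F ->
  ~~ connect (adj (F :\ [set x; y])) x y.
Proof.
move=> forF xy xyF; apply/negP => /connectP[p0 /shortenP[p pP Up _] yE].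
suff cS : simple_cycle (x :: p).
  have /negP[] := forF _ cS; rewrite cycle_edges_sub //= rcons_path -yE.
  rewrite {2}/adj /= setUC xyF andbT; apply: sub_path pP => u v.
  by rewrite /adj /= in_setD => /andP[].
rewrite /simple_cycle Up andbT; case: p pP {Up} yE => [_ /= yx|z [|? ?] //=].
  by rewrite yx eqxx in xy.
by move=> /andP[xz _] yz; move: xz; rewrite yz /adj /= in_setD1 eqxx.
Qed.

Lemma forestS F F' : F \subset F' -> forest F' -> forest F.
Proof.
by move=> sF forF c cS; apply: contra (forF c cS) => /subset_trans; apply.
Qed.

Lemma forest0 : forest (set0 : {set {set T}}).
Proof.
move=> [|x c] // _; apply/negP=> /subsetP sub.
have /sub : [set x; next (x :: c) x] \in cycle_edges (x :: c).
  by apply: imset_f; rewrite mem_head.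
by rewrite inE.
Qed.

Lemma cycle_const (U : Type) (r : T -> U) c : uniq c ->
  {in c, forall x, r (prev c x) = r x} -> {in c &, forall x y, r x = r y}.
Proof.
move=> Uc step x y xc yc.
have : fconnect (next c) x y by rewrite (fconnect_cycle (cycle_next Uc)).
move/iter_findex <-; elim: (findex _ _ _) => // n ->.
have iterc : iter n.+1 (next c) x \in c by elim: n.+1 => //= m; rewrite mem_next.
by rewrite -(step _ iterc) /= prev_next.
Qed.

Lemma connect_around (U : finType) (e : rel U) (r : T -> U) c x :
  uniq c -> x \in c ->
  {in c, forall y, y != x -> connect e (r (prev c y)) (r y)} ->
  connect e (r x) (r (prev c x)).
Proof.
move=> Uc xc step.
have iterc n : iter n (next c) x \in c by elim: n => //= n; rewrite mem_next.
have conn n : connect e (r x) (r (iter n (next c) x)).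
  elim: n => //= n IH; have [->|neq] := eqVneq (next c (iter n (next c) x)) x.
    exact: connect0.
  apply: connect_trans IH _.
  by rewrite -{1}[iter n _ _](prev_next Uc); apply: step; rewrite ?mem_next.
have : fconnect (next c) x (prev c x).
  by rewrite (fconnect_cycle (cycle_next Uc)) // mem_prev.
by move/iter_findex <-.
Qed.

End Forests.

Lemma connect_inj (T U : finType) (h : T -> U) (F : {set {set T}}) x y :
  injective h -> connect (adj [set h @: (e : {set T}) | e in F]) (h x) (h y) ->
  connect (adj F) x y.
Proof.
move=> injh /connectP[p]; elim: p x => [|z p IH] x /= => [_ /injh->|].
  exact: connect0.
case/andP=> /imsetP[e eF E] pP yl.
have /imsetP[t te zt] : z \in h @: e by rewrite -E set22.
rewrite {z}zt in E pP yl *; apply: (connect_trans _ (IH t pP yl)).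
apply: connect1; rewrite /adj /=; suff -> : [set x; t] = e by [].
by apply: (imset_inj injh); rewrite imsetU1 imset_set1.
Qed.

Lemma forest_inj (T U : finType) (h : T -> U) (F : {set {set T}}) :
  injective h -> forest [set h @: (e : {set T}) | e in F] <-> forest F.
Proof.
move=> injh; have hE x y : h @: [set x; y] = [set h x; h y].
  by rewrite imsetU1 imset_set1.
have hF x y : adj [set h @: (e : {set T}) | e in F] (h x) (h y) = adj F x y.
  by rewrite /adj /= -hE mem_imset //; apply: imset_inj.
split=> forF c /[dup]/andP[c3 Uc] cS.
  have hcS: simple_cycle (map h c) by rewrite /simple_cycle size_map map_inj_uniq ?c3.
  move: (forF _ hcS); rewrite !cycle_edges_sub ?map_inj_uniq //.
  by apply: contra; apply: homo_cycle => x y; rewrite hF.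
apply/negP; rewrite cycle_edges_sub // => cyc.
have codc x : x \in c -> exists y, x = h y.
  move=> /(next_cycle cyc) /imsetP[e _ xe].
  have: x \in h @: e by rewrite -xe set21.
  by case/imsetP=> y _ ->; exists y.
have [d dE] : exists d, c = map h d.
  elim: (c) codc => [|x s IHs] codc; first by exists [::].
  have [|d ->] := IHs; first by move=> y ys; apply: codc; rewrite inE ys orbT.
  by have [|y ->] := codc x; [rewrite inE eqxx | exists (y :: d)].
move: c3 Uc cyc; rewrite dE size_map map_inj_uniq // => d3 Ud cyc.
have /negP[] : ~~ (cycle_edges d \subset F) by apply: forF; apply/andP.
rewrite cycle_edges_sub //; move: cyc; rewrite cycle_map; by apply: sub_cycle => x y; rewrite /relpre /= -hF.
Qed.
(** * Vines as families of sets *)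

Section Families.
Variable V : finType.
Implicit Types (F : {set {set V}}) (a b u v w x y z : {set V}) (i j h : V).

Definition fcov F v := [set x in F | (x \subset v) && (#|x|.+1 == #|v|)].

Definition flevel F (r : nat) := [set fcov F v | v in F & #|v| == r.+1].

Definition fbelow F u (r : nat) :=
  [set fcov F v | v in F & (v \subset u) && (#|v| == r.+1)].

Definition least F a v :=
  [&& v \in F, a \subset v & [forall u in F, (a \subset u) ==> (v \subset u)]].

Lemma leastP F a v : reflect [/\ v \in F, a \subset v &
  forall u, u \in F -> a \subset u -> v \subset u] (least F a v).
Proof.
apply: (iffP and3P) => -[vF av]; first by move/forall_inP=> vle; split=> // u /vle/implyP.
by move=> vle; split=> //; apply/forall_inP=> u /vle ?; apply/implyP.
Qed.

Lemma sub2P i j v : reflect (i \in v /\ j \in v) ([set i; j] \subset v).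
Proof. by rewrite subUset !sub1set; apply: andP. Qed.

Definition lower_pair F v x y : Prop :=
  [/\ x \in F, y \in F, #|x|.+1 = #|v|, #|y|.+1 = #|v| & x :|: y = v]
  /\ (2 < #|v| -> x :&: y \in F)
  /\ (forall w, w \in F -> w \proper v -> (w \subset x) || (w \subset y)).

(* An LR-vine, with every element replaced by the set of minimal elements
   below it. *)
Definition lr_family F : Prop :=
  [/\ set0 \notin F,
      forall u i, u \in F -> i \in u -> [set i] \in F,
      forall v, v \in F -> 1 < #|v| -> exists x y, lower_pair F v x y
    & forall r, 0 < r -> forest (flevel F r)].

Lemma lower_pair_facts F v x y : lower_pair F v x y ->
  [/\ x \proper v, y \proper v, x != y & #|x :&: y|.+2 = #|v|].
Proof.
case=> -[xF yF cx cy xyv] _.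
have sx : x \subset v by rewrite -xyv subsetUl.
have sy : y \subset v by rewrite -xyv subsetUr.
rewrite !properEcard sx sy; split; try nlia.
  by apply/eqP=> xy; move: cx; rewrite -xyv xy setUid; nlia.
by have := cardsUI x y; rewrite xyv; nlia.
Qed.

Lemma lower_pair_fcov F v x y : lower_pair F v x y -> fcov F v = [set x; y].
Proof.
move=> vxy; have [xv yv _ _] := lower_pair_facts vxy.
case: vxy => -[xF yF cx cy xyv] [_ low]; apply/setP=> w; rewrite !inE.
apply/and3P/orP => [[wF wv /eqP cw]|[]/eqP->].
- have /low/orP[] // : w \proper v by rewrite properEcard wv -cw leqnn.
    by move=> wx; left; rewrite eqEcard wx; nlia.
  by move=> wy; right; rewrite eqEcard wy; nlia.
- by rewrite xF cx proper_sub.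
- by rewrite yF cy proper_sub.
Qed.

Lemma fbelow_level F u r : fbelow F u r \subset flevel F r.
Proof.
apply/subsetP=> e /imsetP[v]; rewrite inE => /and3P[vF _ vr] ->.
by apply: imset_f; rewrite inE vF.
Qed.

Lemma fbelowS F u v r : u \subset v -> fbelow F u r \subset fbelow F v r.
Proof.
move=> uv; apply/subsetP=> e /imsetP[w]; rewrite inE => /and3P[wF wu wr] ->.
by apply: imset_f; rewrite inE wF wr (subset_trans wu uv).
Qed.

Lemma fbelow_below F u r a b : adj (fbelow F u r) a b ->
  [/\ a \in F, #|a| = r, a \subset u & exists v,
    [/\ v \in F, #|v| = r.+1, v \subset u, [set a; b] = fcov F v & a \subset v]].
Proof.
case/imsetP=> v; rewrite inE => /and3P[vF vu /eqP vr] E.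
have : a \in fcov F v by rewrite -E set21.
rewrite inE vr eqSS => /and3P[aF av /eqP ar].
by split=> //; [apply: subset_trans vu | exists v].
Qed.

Section Fam.
Variable F : {set {set V}}.
Hypothesis lrF : lr_family F.

Lemma fam_card_gt0 v : v \in F -> 0 < #|v|.
Proof.
case: lrF => F0 _ _ _ vF; rewrite card_gt0.
by apply: contraNneq F0 => <-.
Qed.

Lemma fcov_inj u v : u \in F -> v \in F -> 1 < #|u| -> 1 < #|v| ->
  fcov F u = fcov F v -> u = v.
Proof.
case: lrF => _ _ low _ uF vF u1 v1.
have [x [y uxy]] := low _ uF u1; have [x' [y' vxy]] := low _ vF v1.
rewrite (lower_pair_fcov uxy) (lower_pair_fcov vxy) => E.
have [[_ _ _ _ <-] _] := uxy; have [[_ _ _ _ <-] _] := vxy.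
have cov (s t : {set V}) : s :|: t = \bigcup_(w in [set s; t]) w.
  apply/setP=> k; rewrite inE; apply/orP/bigcupP=> [[]kk|[w]].
  - by exists s; rewrite ?set21.
  - by exists t; rewrite ?set22.
  - by rewrite !inE => /orP[]/eqP->; [left|right].
by rewrite !cov E.
Qed.

Lemma fam_subset_card v r : v \in F -> 0 < r <= #|v| ->
  exists2 w, w \in F & w \subset v /\ #|w| = r.
Proof.
case: lrF => _ _ low _.
have [n] := ubnP #|v|; elim: n v => // n IH v; rewrite ltnS => vn vF /andP[r0].
rewrite leq_eqVlt => /orP[/eqP->|rv]; first by exists v.
have [|x [y vxy]] := low _ vF; first by nlia.
have [xv _ _ _] := lower_pair_facts vxy; have [[xF _ cx _ _] _] := vxy.
have [||//|w wF [wx wr]] := IH x; [by nlia| by []| by nlia|].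
by exists w => //; rewrite (subset_trans wx) // proper_sub.
Qed.

Lemma fam_connect v a b : v \in F -> a \in F -> b \in F ->
  a \subset v -> b \subset v -> #|a| = #|b| ->
  connect (adj (fbelow F v #|a|)) a b.
Proof.
case: (lrF) => _ _ low _; have [n] := ubnP #|v|.
elim: n v a b => // n IH v a b; rewrite ltnS => vn vF aF bF av bv ab.
have [v1|v1] := leqP #|a|.+1 #|v|; last first.
  have -> : a = v by apply/eqP; rewrite eqEcard av.
  suff -> : b = v by exact: connect0.
  by apply/eqP; rewrite eqEcard bv -ab.
have a0 := fam_card_gt0 aF.
have [|x [y vxy]] := low _ vF; first by nlia.
have [xv yv _ cxy] := lower_pair_facts vxy.
have E := lower_pair_fcov vxy; have [[xF yF cx cy vE] [xyF lowv]] := vxy.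
have covV (c : {set V}) : c \in F -> c \subset v -> #|c| = #|a| ->
    (c \subset x) || (c \subset y).
  by move=> cF cv ca; apply: lowv => //; rewrite properEcard cv ca.
have up (t c d : {set V}) : t \proper v -> connect (adj (fbelow F t #|a|)) c d ->
    connect (adj (fbelow F v #|a|)) c d.
  by move/proper_sub/(fbelowS F #|a|)/connect_adjS; apply.
have [va|va] := eqVneq #|v| #|a|.+1.
  have inxy (c : {set V}) : c \in F -> c \subset v -> #|c| = #|a| -> c \in [set x; y].
    move=> cF cv ca; rewrite !inE.
    have xa : #|x| = #|c| by move: cx; rewrite va ca => -[].
    have ya : #|y| = #|c| by move: cy; rewrite va ca => -[].
    have := covV c cF cv ca.
    by rewrite [_ == x]eqEcard [_ == y]eqEcard xa ya leqnn !andbT.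
  have xy : connect (adj (fbelow F v #|a|)) x y.
    by apply: connect1; rewrite /adj /= -E; apply: imset_f; rewrite inE vF subxx va eqxx.
  have yx : connect (adj (fbelow F v #|a|)) y x by rewrite adj_connect_sym.
  move: xy yx (inxy _ aF av erefl) (inxy _ bF bv (esym ab)).
  move: #|a| => r xy yx; rewrite !inE => /orP[]/eqP-> /orP[]/eqP-> //; apply: connect0.
have [||w wF [wxy wr]] := @fam_subset_card (x :&: y) #|a|.
- by apply: xyF; nlia.
- by nlia.
have /subsetIP[wx wy] := wxy.
have toW (c : {set V}) : c \in F -> c \subset v -> #|c| = #|a| ->
    connect (adj (fbelow F v #|a|)) c w.
  move=> cF cv ca; have /orP[cs|cs] := covV _ cF cv ca.
    by apply: (up x) => //; rewrite -ca; apply: IH; rewrite // ?ca ?wr //; nlia.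
  by apply: (up y) => //; rewrite -ca; apply: IH; rewrite // ?ca ?wr //; nlia.
by apply: connect_trans (toW a _ _ _) _ => //; rewrite adj_connect_sym; apply: toW.
Qed.

Lemma fam_first_edge v a b : v \in F -> a \in F -> b \in F ->
  a \subset v -> b \subset v -> #|a| = #|b| -> a != b ->
  exists f z, [/\ f \in F, #|f| = #|a|.+1, a \subset f, f \subset v &
    [/\ fcov F f = [set a; z], a != z &
        connect (adj (fbelow F v #|a| :\ fcov F f)) z b]].
Proof.
move=> vF aF bF av bv ab neq.
have /connectP[p0 /shortenP[[|z p] pP Up _] bE] := fam_connect vF aF bF av bv ab.
  by rewrite bE eqxx in neq.
move: pP Up => /= /andP[/fbelow_below[_ _ _ [f [fF cf fv E af]]] pP] /andP[ap Up].
exists f, z; split=> //.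
have az : a != z by apply: contraNneq ap => ->; rewrite inE eqxx.
split=> //; apply/connectP; exists p => //; rewrite -E.
by apply: path_avoid pP ap _; apply: set21.
Qed.

Lemma fam_bridge r f a z : f \in F -> #|f| = r.+1 -> 0 < r -> a != z ->
  fcov F f = [set a; z] -> ~~ connect (adj (flevel F r :\ fcov F f)) a z.
Proof.
case: lrF => _ _ _ forF fF cf r0 az E; rewrite E.
apply: forest_bridge => //; first exact: forF.
by rewrite -E; apply: imset_f; rewrite inE fF cf eqxx.
Qed.

Lemma fbelow_avoid u r f : f \in F -> #|f| = r.+1 -> 0 < r ->
  ~~ (f \subset u) -> fbelow F u r \subset flevel F r :\ fcov F f.
Proof.
move=> fF cf r0 fu; rewrite subsetD1 fbelow_level /=.
apply: contra fu => /imsetP[g]; rewrite inE => /and3P[gF gu /eqP cg] /fcov_inj.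
by move=> -> //; nlia.
Qed.

Lemma fam_first_below u v a b : u \in F -> v \in F -> a \in F -> b \in F ->
  a \subset u :&: v -> b \subset u :&: v -> #|a| = #|b| -> a != b ->
  exists f, [/\ f \in F, #|f| = #|a|.+1, a \subset f & f \subset u :&: v].
Proof.
move=> uF vF aF bF /subsetIP[au av] /subsetIP[bu bv] ab neq.
have [f [z [fF cf af fu [E az zb]]]] := fam_first_edge uF aF bF au bu ab neq.
have a0 := fam_card_gt0 aF.
exists f; split=> //; rewrite subsetI fu /=.
apply: contraT => fv; have /negP[] := fam_bridge fF cf a0 az E.
apply: (@connect_trans _ _ b).
  apply: connect_adjS (fam_connect vF aF bF av bv ab).
  exact: fbelow_avoid.
rewrite adj_connect_sym; apply: connect_adjS zb.
by apply: setSD; apply: fbelow_level.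
Qed.

Lemma fam_inter u v : u \in F -> v \in F -> u :&: v != set0 -> u :&: v \in F.
Proof.
move=> uF vF /set0Pn[i0 i0uv].
have sF i : i \in u -> [set i] \in F by case: lrF => _ sF _ _ /(sF _ _ uF).
pose D := [set w in F | w \subset u :&: v].
have D0 : [set i0] \in D.
  by rewrite inE sub1set i0uv sF //; case/setIP: i0uv.
case: (@arg_maxnP _ [set i0] (mem D) (fun w => #|w|) D0) => w wD wmax.
suff -> : u :&: v = w by move: wD; rewrite /= inE => /andP[].
move: (wD); rewrite /= inE => /andP[wF wuv].
apply/eqP; rewrite eqEsubset wuv andbT; apply/subsetP=> i iuv.
pose Di := [set w in D | i \in w].
have Di0 : [set i] \in Di.
  by rewrite !inE sub1set iuv eqxx sF //; case/setIP: iuv.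
case: (@arg_maxnP _ [set i] (mem Di) (fun w => #|w|) Di0) => a aD amax.
move: (aD); rewrite /= !inE => /andP[/andP[aF auv] ia].
have aw : #|a| <= #|w| by apply: wmax; rewrite /= inE aF auv.
have [|b bF [bw ba]] := @fam_subset_card w #|a| wF.
  by rewrite aw fam_card_gt0.
have [ab|ab] := eqVneq a b; first by rewrite (subsetP bw) // -ab.
have buv := subset_trans bw wuv.
have [f [fF cf af fuv]] := fam_first_below uF vF aF bF auv buv (esym ba) ab.
have := amax f; rewrite /= !inE fF fuv (subsetP af) // cf => /(_ isT).
by nlia.
Qed.

Lemma fam_cycle (T : finType) (c : seq T) (g J : T -> {set V}) (r : nat) :
  simple_cycle c -> {in c &, injective g} ->
  {in c, forall t, [/\ g t \in F, #|g t| = r & J t \in F]} ->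
  {in c, forall t, g t \subset J t /\ g (next c t) \subset J t} ->
  exists s t, [/\ s \in c, t \in c, t != s, t != next c s & g t \subset J s].
Proof.
move=> cS; have /andP[c3 Uc] := cS.
have [n] := ubnP (#|V| - r); elim: n g r => // n IH g r; rewrite ltnS => rn.
move=> injg gF gJ.
pose chord := [exists s : T, [exists t : T,
  [&& s \in c, t \in c, t != s, t != next c s & g t \subset J s]]].
have [/existsP[s /existsP[t /and5P[? ? ? ? ?]]]|nochord] := boolP chord.
  by exists s, t.
have noch s t : s \in c -> t \in c -> g t \subset J s -> (t == s) || (t == next c s).
  move=> sc tc ts; apply: contraNT nochord; rewrite negb_or => /andP[n1 n2].
  by apply/existsP; exists s; apply/existsP; exists t; rewrite sc tc n1 n2.
have [f fP] : exists f : T -> {set V}, {in c, forall t,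
    [/\ f t \in F, #|f t| = r.+1, g t \subset f t, f t \subset J t
      & f t \subset J (prev c t)]}.
  suff /fin_all_exists[f fP] : forall t, exists ft, t \in c -> [/\ ft \in F, #|ft| = r.+1, g t \subset ft, ft \subset J t
      & ft \subset J (prev c t)] by exists f.
  move=> t; have [tc|tc] := boolP (t \in c); last by exists set0.
  have ntc : next c t \in c by rewrite mem_next.
  have [aF car JF] := gF _ tc; have [bF cbr _] := gF _ ntc; have [aJ bJ] := gJ _ tc.
  have r0 : 0 < r by rewrite -car fam_card_gt0.
  have ab : g t != g (next c t).
    by apply: contraNneq (next_neq cS tc) => /(injg _ _ tc ntc) <-.
  have [f [z [fF cf af fJ [E az zb]]]] :=
    fam_first_edge JF aF bF aJ bJ (etrans car (esym cbr)) ab.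
  rewrite car in cf zb; exists f => _; split=> //.
  apply: contraT => fpJ; have /negP[] := fam_bridge fF cf r0 az E.
  rewrite adj_connect_sym; apply: (@connect_trans _ _ (g (next c t))).
    by apply: connect_adjS zb; apply: setSD; apply: fbelow_level.
  rewrite -{2}[t](next_prev Uc).
  apply: (@connect_around _ _ _ (fun s => g (next c s))) => // s sc st.
  rewrite next_prev //; have [sF csr sJF] := gF _ sc; have [sJ nsJ] := gJ _ sc.
  have [nF cnr _] := gF (next c s) ltac:(by rewrite mem_next).
  suff fs : ~~ (f \subset J s).
    apply: connect_adjS (fbelow_avoid fF cf r0 fs) _ _ _.
    by rewrite -csr; apply: fam_connect => //; rewrite csr.
  apply: contra fpJ => fs; have /orP[/eqP ts|/eqP->] := noch s t sc tc (subset_trans af fs).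
    by rewrite ts eqxx in st.
  by rewrite prev_next.
have [||| |s [t [sc tc ts tns tJ]]] := IH f r.+1.
- have := c3; case: (c) fP => // t0 c0 fP _.
  have [_ cf _ _ _] := fP t0 (mem_head _ _).
  by have := max_card (mem (f t0)); rewrite cf; nlia.
- move=> s t sc tc fst; apply/eqP; apply: contraT => st.
  have [_ _ _ sJ sJp] := fP s sc; have [_ _ gt _ _] := fP t tc.
  have := noch s t sc tc; rewrite fst in sJ sJp; rewrite (subset_trans gt sJ) => /(_ isT).
  rewrite eq_sym (negPf st) /= => /eqP tn.
  have := noch (prev c s) t; rewrite mem_prev sc tc (subset_trans gt sJp) next_prev //.
  move=> /(_ isT isT isT); rewrite [t == s]eq_sym (negPf st) orbF tn.
  by rewrite (negPf (next_neq_prev cS sc)).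
- by move=> t /[dup] /fP[? ? ? ? ?] /gF[].
- move=> t tc; have [_ _ _ tJ _] := fP t tc; split=> //.
  have [|_ _ _ _] := fP (next c t); first by rewrite mem_next.
  by rewrite prev_next.
exists s, t; split=> //; have [_ _ gf _ _] := fP t tc.
exact: subset_trans gf tJ.
Qed.

Lemma fam_least a u : u \in F -> a \subset u -> a != set0 ->
  exists v, least F a v.
Proof.
move=> uF au /set0Pn[i ia]; pose D := [set w in F | a \subset w].
have uD : u \in D by rewrite inE uF.
case: (@arg_minnP _ u (mem D) (fun w => #|w|) uD) => v.
rewrite /= inE => /andP[vF av] vmin; exists v; apply/leastP; split=> // w wF aw.
have vwF : w :&: v \in F.
  by apply: fam_inter => //; apply/set0Pn; exists i; rewrite inE !(subsetP _ _ ia).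
have := vmin (w :&: v); rewrite /= inE vwF subsetI aw av => /(_ isT) le.
have /eqP <- : w :&: v == v by rewrite eqEcard subsetIr.
exact: subsetIl.
Qed.

Lemma fam_vertex_cycle c (J : V -> {set V}) : simple_cycle c ->
  {in c, forall i, [/\ J i \in F, i \in J i & next c i \in J i]} ->
  exists i j, [/\ i \in c, j \in c, j != i, j != next c i & j \in J i].
Proof.
move=> cS cJ; have sF i : i \in c -> [set i] \in F.
  by move=> /cJ[JF iJ _]; case: lrF => _ sF _ _; apply: sF JF iJ.
have [|i ic|i /cJ[_ ? ?]|i [j [ic jc ji jn ij]]] :=
    @fam_cycle _ c (fun i => [set i]) J 1 cS.
- by move=> i j _ _ /set1_inj.
- by rewrite cards1 sF //; case: (cJ i ic).
- by rewrite !sub1set.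
by exists i, j; rewrite -sub1set.
Qed.

Lemma fam_triangle i j h u v w : i != j -> j != h -> h != i ->
  u \in F -> v \in F -> w \in F -> i \in u -> j \in u -> j \in v -> h \in v ->
  h \in w -> i \in w -> [\/ h \in u, i \in v | j \in w].
Proof.
move=> ij jh hi uF vF wF iu ju jv hv hw iw.
pose J t := if t == i then u else if t == j then v else w.
have [||s [t []]] := @fam_vertex_cycle [:: i; j; h] J.
- by rewrite /simple_cycle /= !inE negb_or ij jh eq_sym hi.
- move=> t; rewrite !inE /J => /or3P[]/eqP->; rewrite /= ?eqxx.
  + by [].
  + by rewrite (eq_sym j) (negPf ij).
  + by rewrite (negPf hi) (eq_sym h j) (negPf jh).
rewrite !inE /J => /or3P[]/eqP-> /or3P[]/eqP->; rewrite /= ?eqxx //.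
- by constructor 1.
- by rewrite ![j == i]eq_sym (negPf ij); constructor 2.
- by rewrite ![j == i]eq_sym (negPf ij) eqxx.
- by rewrite (negPf hi) (eq_sym h j) (negPf jh) eqxx.
- by rewrite (negPf hi) (eq_sym h j) (negPf jh); constructor 3.
Qed.

Lemma fam_square i h j k u v w z : uniq [:: i; h; j; k] ->
  u \in F -> v \in F -> w \in F -> z \in F -> i \in u -> h \in u ->
  h \in v -> j \in v -> j \in w -> k \in w -> k \in z -> i \in z ->
  exists2 t, t \in F & ([set i; j] \subset t) || ([set h; k] \subset t).
Proof.
move=> /[dup] U /and4P[]; rewrite !inE !negb_or => /and3P[ih ij ik].
move=> /andP[hj hk] jk _ uF vF wF zF iu hu hv jv jw kw kz iz.
pose J t := if t == i then u else if t == h then v else if t == j then w else z.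
have Ji : J i = u by rewrite /J eqxx.
have Jh : J h = v by rewrite /J eq_sym (negPf ih) eqxx.
have Jj : J j = w by rewrite /J eq_sym (negPf ij) eq_sym (negPf hj) eqxx.
have Jk : J k = z.
  by rewrite /J ![k == _]eq_sym (negPf ik) (negPf hk) (negPf jk).
have ni : next [:: i; h; j; k] i = h by rewrite /= eqxx.
have nh : next [:: i; h; j; k] h = j by rewrite /= (eq_sym h) (negPf ih) eqxx.
have nj : next [:: i; h; j; k] j = k.
  by rewrite /= ![j == _]eq_sym (negPf ij) (negPf hj) eqxx.
have nk : next [:: i; h; j; k] k = i.
  by rewrite /= ![k == _]eq_sym (negPf ik) (negPf hk) (negPf jk) eqxx.
have [||s [t []]] := @fam_vertex_cycle [:: i; h; j; k] J.
- by rewrite /simple_cycle U.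
- by move=> t; rewrite !inE => /or4P[]/eqP->; rewrite ?Ji ?Jh ?Jj ?Jk ?ni ?nh ?nj ?nk.
have sub t' (a b c d : V) : t' \in F ->
    a \in t' /\ b \in t' \/ c \in t' /\ d \in t' ->
    exists2 t0, t0 \in F & ([set a; b] \subset t0) || ([set c; d] \subset t0).
  by move=> t'F H; exists t' => //; apply/orP; case: H => ?; [left|right]; apply/sub2P.
rewrite !inE => /or4P[]/eqP-> /or4P[]/eqP->;
  rewrite ?Ji ?Jh ?Jj ?Jk ?ni ?nh ?nj ?nk ?eqxx // => _ _ tJ;
  by [apply: (sub u); auto | apply: (sub v); auto
     | apply: (sub w); auto | apply: (sub z); auto].
Qed.

Lemma fam_clique (S : {set V}) : S != set0 ->
  {in S &, forall i j, exists2 u, u \in F & [set i; j] \subset u} ->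
  exists2 v, v \in F & S \subset v.
Proof.
move=> /set0Pn[i0 i0S] cl.
have cle i j : i \in S -> j \in S -> exists v, least F [set i; j] v.
  move=> iS jS; have [u uF iju] := cl _ _ iS jS.
  by apply: fam_least uF iju _; apply/set0Pn; exists i; rewrite set21.
pose D := [set v | [exists i in S, [exists j in S, least F [set i; j] v]]].
have inD i j v : i \in S -> j \in S -> least F [set i; j] v -> v \in D.
  move=> iS jS L; rewrite inE; apply/exists_inP; exists i => //.
  by apply/exists_inP; exists j.
have [v0 v0L] := cle _ _ i0S i0S.
case: (@arg_maxnP _ v0 (mem D) (fun w => #|w|) (inD _ _ _ i0S i0S v0L)) => v /=.
rewrite inE => /exists_inP[i iS /exists_inP[j jS /[dup] Lv /leastP[vF]]].
move=> /sub2P[iv jv] vle vmax; exists v => //; apply/subsetP=> s sS.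
have [a /[dup] La /leastP[aF /sub2P[ia sa] ale]] := cle _ _ iS sS.
have [b /[dup] Lb /leastP[bF /sub2P[jb sb] ble]] := cle _ _ jS sS.
have av := vmax _ (inD _ _ _ iS sS La); have bv := vmax _ (inD _ _ _ jS sS Lb).
have inv w : w \in F -> #|w| <= #|v| -> i \in w -> j \in w -> s \in w -> s \in v.
  move=> wF wv iw jw; suff /eqP -> : v == w by [].
  by rewrite eqEcard wv vle //; apply/sub2P.
have [<- //|is_] := eqVneq i s; have [<- //|js] := eqVneq j s.
have [ij|ij] := eqVneq i j; first by apply: (inv a); rewrite -?ij.
have si : s != i by rewrite eq_sym.
have [//|ib|ja] := fam_triangle ij js si vF bF aF iv jv jb sb sa ia.
- exact: (inv b).
- exact: (inv a).
Qed.

Lemma fam_pair v : v \in F -> 1 < #|v| -> exists i j,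
  [/\ i != j, least F [set i; j] v
    & {in v &, forall s t, s != t -> [set s; t] != [set i; j] ->
        exists2 w, w \in F & w \proper v /\ [set s; t] \subset w}].
Proof.
move=> vF v1; case: (lrF) => _ _ /(_ v vF v1)[x [y vxy]] _.
have [xv yv _ cxy] := lower_pair_facts vxy.
case: vxy => -[xF yF cx cy xyv] [_ low].
have /cards1P[i iE] : #|x :\: y| == 1 by have := cardsID y x; nlia.
have /cards1P[j jE] : #|y :\: x| == 1 by have := cardsID x y; rewrite setIC; nlia.
have /setDP[ix iy] : i \in x :\: y by rewrite iE set11.
have /setDP[jy jx] : j \in y :\: x by rewrite jE set11.
exists i, j; split.
- by apply: contraNneq iy => ->.
- apply/leastP; split=> // [|u uF /sub2P[iu ju]].
    by apply/sub2P; rewrite -xyv !inE ix jy orbT.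
  have : u :&: v \in F.
    by apply: fam_inter => //; apply/set0Pn; exists i; rewrite inE iu -xyv inE ix.
  have [<- _|neq /low] := eqVneq (u :&: v) v; first exact: subsetIl.
  rewrite properEneq neq subsetIr => /(_ isT)/orP[]/subsetP.
    by move/(_ j); rewrite inE ju -xyv inE jy orbT (negPf jx) => /(_ isT).
  by move/(_ i); rewrite inE iu -xyv inE ix (negPf iy) => /(_ isT).
move=> s t; rewrite -xyv => sv tv st neq.
have [sx|sx] := boolP (s \in x); have [tx|tx] := boolP (t \in x).
- by exists x => //; split; [rewrite xyv | apply/sub2P].
- have ty : t \in y by move: tv; rewrite inE (negPf tx).
  have tj : t = j by apply/set1P; rewrite -jE inE tx.
  have [sy|sy] := boolP (s \in y).
    by exists y => //; split; [rewrite xyv | apply/sub2P].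
  have si : s = i by apply/set1P; rewrite -iE inE sy.
  by rewrite si tj eqxx in neq.
- have sy : s \in y by move: sv; rewrite inE (negPf sx).
  have sj : s = j by apply/set1P; rewrite -jE inE sx.
  have [ty|ty] := boolP (t \in y).
    by exists y => //; split; [rewrite xyv | apply/sub2P].
  have ti : t = i by apply/set1P; rewrite -iE inE ty.
  by rewrite sj ti setUC eqxx in neq.
- exists y => //; split; first by rewrite xyv.
  by apply/sub2P; move: sv tv; rewrite !inE (negPf sx) (negPf tx).
Qed.

Lemma least_pair_card i j v : i != j -> least F [set i; j] v -> 1 < #|v|.
Proof. by move=> ij /leastP[_ /subset_leq_card + _]; rewrite cards2 ij. Qed.

Lemma least_pair_lower i j v s t : i != j -> least F [set i; j] v ->
  s \in v -> t \in v -> s != t -> [set s; t] != [set i; j] ->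
  exists2 w, w \in F & w \proper v /\ [set s; t] \subset w.
Proof.
move=> ij L sv tv st neq; have /leastP[vF /sub2P[iv jv] vle] := L.
have [i' [j' [_ _ low]]] := fam_pair vF (least_pair_card ij L).
have ijE : [set i; j] = [set i'; j'].
  apply/eqP; apply: contraT => /(low _ _ iv jv ij)[w wF [wv /(vle _ wF) vw]].
  by rewrite properE vw andbF in wv.
by apply: low => //; rewrite -ijE.
Qed.

Lemma least_pair_inj i j s t v : i != j -> s != t ->
  least F [set i; j] v -> least F [set s; t] v -> [set s; t] = [set i; j].
Proof.
move=> ij st L /leastP[_ /sub2P[sv tv] vle]; apply/eqP; apply: contraT => neq.
have [w wF [wv /(vle _ wF) vw]] := least_pair_lower ij L sv tv st neq.
by rewrite properE vw andbF in wv.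
Qed.

Lemma fam_conditioning i j h v : i != j -> least F [set i; j] v ->
  h \in v :\: [set i; j] <->
  [/\ h != i, h != j, exists2 a, a \in F & [set i; h] \subset a /\ #|a| < #|v|
    & exists2 b, b \in F & [set j; h] \subset b /\ #|b| < #|v|].
Proof.
move=> ij L; have /leastP[vF /sub2P[iv jv] vle] := L.
split=> [/setDP[hv]|[hi hj [a aF [/sub2P[ia ha] av]] [b bF [/sub2P[jb hb] bv]]]].
  rewrite !inE negb_or => /andP[hi hj].
  have cov s : s \in [set i; j] -> exists2 a, a \in F & [set s; h] \subset a /\ #|a| < #|v|.
    move=> sij; have sv : s \in v by move: sij; rewrite !inE => /orP[]/eqP->.
    have sh : s != h by move: sij; rewrite !inE => /orP[]/eqP->; rewrite eq_sym.
    have [|w wF [/proper_card wv ?]] := least_pair_lower ij L sv hv sh; last by exists w.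
    apply/eqP=> E; have : h \in [set i; j] by rewrite -E set22.
    by rewrite !inE (negPf hi) (negPf hj).
  by split=> //; apply: cov; rewrite !inE eqxx ?orbT.
rewrite !inE negb_or hi hj /=.
have nov w : w \in F -> #|w| < #|v| -> i \in w -> j \in w -> h \in v.
  move=> wF wv iw jw; have /subset_leq_card : v \subset w by apply: vle => //; apply/sub2P.
  by nlia.
have jh : j != h by rewrite eq_sym.
have [//|ib|ja] := fam_triangle ij jh hi vF bF aF iv jv jb hb ha ia.
- exact: (nov b).
- exact: (nov a).
Qed.

Definition least_card r : rel V :=
  [rel i j | [exists v, least F [set i; j] v && (#|v| == r)]].

Lemma fam_path3 r i j h u : i != j -> j != h -> i != h -> u \in F -> #|u| <= r ->
  i \in u -> j \in u -> h \in u -> least_card r i j -> ~~ least_card r j h.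
Proof.
move=> ij jh ih uF ur iu ju hu /existsP[v /andP[Lv /eqP vr]].
apply/negP=> /existsP[w /andP[Lw /eqP wr]].
have uE t (a s : V) : a \in u -> s \in u -> least F [set a; s] t -> #|t| = r -> u = t.
  move=> au su /leastP[_ _ tle] tr; apply/esym/eqP.
  by rewrite eqEcard tle // ?tr //; apply/sub2P.
have vw : v = w by rewrite -(uE _ _ _ ju hu Lw wr) -(uE _ _ _ iu ju Lv vr).
rewrite -vw in Lw; have /setP/(_ h) := least_pair_inj ij jh Lv Lw.
by rewrite !inE eqxx orbT eq_sym (negPf ih) eq_sym (negPf jh).
Qed.

Lemma next_split (T : eqType) (x y : T) p q :
  uniq (p ++ x :: y :: q) -> next (p ++ x :: y :: q) x = y.
Proof. by move=> U; rewrite -(next_rot (size p) U) rot_size_cat /= eqxx. Qed.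

Lemma fam_no_path r i p u : uniq (i :: p) -> 1 < size p -> path (least_card r) i p ->
  u \in F -> #|u| <= r -> i \in u -> last i p \in u -> False.
Proof.
have [n] := ubnP (size p); elim: n i p u => // n IH i p u; rewrite ltnS => pn.
move=> Uip p1 pP uF ur iu lu.
have IHs (j : V) (q : seq V) (w : {set V}) s1 s2 : i :: p = s1 ++ (j :: q) ++ s2 ->
    size q < size p -> 1 < size q -> w \in F -> #|w| <= r -> j \in w ->
    last j q \in w -> False.
  move=> E qp q1; apply: IH => //; first exact: leq_trans qp pn.
    by move: Uip; rewrite E !cat_uniq => /and3P[_ _ /andP[]].
  have : sorted (least_card r) (i :: p) by [].
  by rewrite E => /cat_sorted2[_ /cat_sorted2[]].
have noP3 (j k h : V) (w : {set V}) s1 s2 : i :: p = s1 ++ [:: j; k; h] ++ s2 ->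
    w \in F -> #|w| <= r -> j \in w -> k \in w -> h \in w -> False.
  move=> E wF wr jw kw hw.
  have : sorted (least_card r) (i :: p) by [].
  rewrite E => /cat_sorted2[_ /cat_sorted2[/= /and3P[R1 R2 _] _]].
  have : uniq [:: j; k; h] by move: Uip; rewrite E !cat_uniq => /and3P[_ _ /andP[]].
  rewrite /= !inE negb_or => /andP[/andP[jk jh] /andP[kh _]].
  by have /negP[] := fam_path3 jk kh jh wF wr jw kw hw R1.
have cyc : cycle [rel s t | [exists w in F, (#|w| <= r) && ([set s; t] \subset w)]] (i :: p).
  rewrite /= rcons_path; apply/andP; split.
    apply: sub_path pP => s t /= /existsP[v /andP[/leastP[vF stv _] /eqP vr]].
    by apply/exists_inP; exists v; rewrite ?vr ?leqnn.
  by apply/exists_inP; exists u => //; rewrite ur; apply/sub2P.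
have [J JP] : exists J : V -> {set V}, forall s, s \in i :: p ->
    [/\ J s \in F, #|J s| <= r, s \in J s & next (i :: p) s \in J s].
  apply: (@fin_all_exists _ _ (fun s (w : {set V}) => s \in i :: p ->
    [/\ w \in F, #|w| <= r, s \in w & next (i :: p) s \in w])) => s.
  have [sc|] := boolP (s \in i :: p); last by exists set0.
  by have /exists_inP[w wF /andP[wr /sub2P[sw nw]]] := next_cycle cyc sc; exists w.
have [||s [t [sc tc ts tn tJ]]] := @fam_vertex_cycle (i :: p) J.
- by rewrite /simple_cycle Uip andbT.
- by move=> s /JP[].
have [JF Jr sJ nJ] := JP s sc; have [q1 [q2 E]] : exists q1 q2, i :: p = q1 ++ s :: q2.
  by case/splitPr: sc => q1 q2; exists q1, q2.
have sizeE := congr1 size E; rewrite size_cat /= in sizeE.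
case: q2 => [|x q2] in E sizeE.
  have sl : s = last i p by rewrite -[last i p]/(last i (i :: p)) E last_cat.
  have ns : next (i :: p) s = i.
    case: q1 E sizeE => [[_ p0]|_ q1 [<-] E _]; first by rewrite p0 in p1.
    by rewrite -(next_rot (size (i :: q1)) Uip) E -cat_cons rot_size_cat /= eqxx.
  rewrite ns in nJ tn; have tp : t \in p by move: tc; rewrite inE (negPf tn).
  clear cyc JP sc tc ns.
  case/splitPr: p / tp => [[|a r1] [|b r2]] in Uip p1 pn pP lu sl ts E IHs noP3 sizeE *.
  - by [].
  - case: r2 => [|b' r2] in Uip p1 pn pP lu sl ts E IHs noP3 sizeE *.
      by apply: (noP3 i t b (J s) [::] [::]) => //; rewrite -[b]sl.
    apply: (IHs t (b :: b' :: r2) (J s) [:: i] [::]) => //; first by rewrite cats0.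
    by move: sJ; rewrite {1}sl.
  - by move: ts; rewrite sl last_cat /= eqxx.
  apply: (IHs i (rcons (a :: r1) t) (J s) [::] (b :: r2)) => //.
  - by rewrite -cats1 /= -!catA.
  - by rewrite !size_cat size_rcons /=; nlia.
  - by rewrite size_rcons.
  - by rewrite last_rcons.
have ns : next (i :: p) s = x by move: (Uip); rewrite E; apply: next_split.
rewrite ns in nJ tn.
move: tc; rewrite E mem_cat !inE (negPf ts) (negPf tn) /= => /orP[] tq.
  case/splitPr: q1 / tq => r1 [|a r2] in E sizeE *.
    by apply: (noP3 t s x (J s) r1 q2) => //; rewrite E -catA.
  apply: (IHs t (rcons (a :: r2) s) (J s) r1 (x :: q2)) => //.
  - by rewrite E -cats1 /= -!catA /=.
  - by move: sizeE; rewrite size_cat size_rcons /=; nlia.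
  - by rewrite size_rcons.
  - by rewrite last_rcons.
case/splitPr: q2 / tq => [[|a r1] r2] in E sizeE *.
  by apply: (noP3 s x t (J s) q1 r2) => //; rewrite E.
apply: (IHs x (rcons (a :: r1) t) (J s) (rcons q1 s) r2) => //.
- by rewrite E -!cats1 /= -!catA /=.
- by move: sizeE; rewrite /= size_cat size_rcons /=; nlia.
- by rewrite size_rcons.
- by rewrite last_rcons.
Qed.

End Fam.
End Families.

Lemma lr_family_below (V : finType) (F : {set {set V}}) (v : {set V}) :
  lr_family F -> lr_family [set u in F | u \subset v].
Proof.
case=> F0 F1 low forF; set Fv := [set _ in _ | _].
have covE u : u \in Fv -> fcov Fv u = fcov F u.
  rewrite inE => /andP[_ uv]; apply/setP=> x; rewrite !inE -andbA.
  by case: (boolP (x \subset u)) => [xu|]; rewrite ?andbF // (subset_trans xu uv).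
split=> [|u i|u|r r0].
- by rewrite inE (negPf F0).
- rewrite !inE => /andP[uF uv] iu; rewrite (F1 u) //= sub1set.
  exact: subsetP uv i iu.
- rewrite inE => /andP[uF uv] /(low u uF)[x [y [[xF yF cx cy xyu] [xyF lowu]]]].
  have xu : x \subset u by rewrite -xyu subsetUl.
  have yu : y \subset u by rewrite -xyu subsetUr.
  exists x, y; rewrite /lower_pair !inE xF yF !(subset_trans _ uv) //;
    last by rewrite subIset ?xu.
  split=> //; split=> [/xyF-> //|w].
  by rewrite inE => /andP[wF _]; apply: lowu.
apply: forestS (forF r r0).
apply/subsetP=> e /imsetP[u]; rewrite inE => /andP[uFv ur] ->.
rewrite covE //; apply: imset_f; rewrite inE ur andbT.
by move: uFv; rewrite inE => /andP[].
Qed.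

(** * Posets represented by families of sets *)

Section Representation.

Definition represents (P : rposet) (V : finType) (phi : P -> {set V}) : Prop :=
  [/\ forall x y, (x <= y)%O = (phi x \subset phi y),
      forall x, rk x = #|phi x|
    & lr_family (phi @: [set: P])].

Variables (P : rposet) (V : finType) (phi : P -> {set V}).
Hypothesis repP : represents phi.
Let F := phi @: [set: P].
Implicit Types (x y z v w t : P).

Lemma rep_le x y : (x <= y)%O = (phi x \subset phi y).
Proof. by case: repP. Qed.

Lemma rep_rk x : rk x = #|phi x|.
Proof. by case: repP. Qed.

Lemma rep_family : lr_family F.
Proof. by case: repP. Qed.

Lemma rep_mem x : phi x \in F.
Proof. by rewrite imset_f. Qed.

Lemma rep_inj : injective phi.
Proof. by move=> x y E; apply/le_anti; rewrite !rep_le E subxx. Qed.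

Lemma rep_lt x y : (x < y)%O = (phi x \proper phi y).
Proof. by rewrite lt_neqAle rep_le properEneq (inj_eq rep_inj). Qed.

Lemma rep_gt0 x : 0 < rk x.
Proof. by rewrite rep_rk (fam_card_gt0 rep_family) ?rep_mem. Qed.

Lemma rep_covers x y :
  covers y x = (phi x \subset phi y) && (#|phi x|.+1 == #|phi y|).
Proof.
apply/andP/andP => [[]|[xy /eqP cxy]].
  rewrite rep_lt => xy /forallP noz; split; first exact: proper_sub.
  have [_ _ low _] := rep_family.
  have y1 : 1 < #|phi y|.
    by have := proper_card xy; have := rep_gt0 x; rewrite rep_rk; nlia.
  have [a [b aby]] := low _ (rep_mem y) y1.
  have [ay by_ _ _] := lower_pair_facts aby.
  have [[aF bF ca cb _] [_ /(_ _ (rep_mem x) xy) xab]] := aby.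
  wlog xa : a b aF bF ca cb ay by_ xab {aby} / phi x \subset a.
    move=> wl; case/orP: (xab) => xa; first exact: (wl a b).
    by apply: (wl b a) => //; rewrite orbC.
  case/imsetP: aF => a' _ aE; rewrite aE in ca ay xa.
  have := noz a'; rewrite !rep_lt ay andbT properE xa /= negbK => ax.
  by rewrite -ca eqSS eqn_leq !subset_leq_card.
have xyp : phi x \proper phi y by rewrite properEcard xy -cxy /=.
split; first by rewrite rep_lt.
apply/forallP => z; rewrite !rep_lt; apply/negP=> /andP[/proper_card + /proper_card].
nlia.
Qed.

Lemma rep_covered v : phi @: covered v = fcov F (phi v).
Proof.
apply/setP=> a; apply/imsetP/idP=> [[x]|].
  by rewrite inE rep_covers => xv ->; rewrite inE rep_mem.
rewrite inE => /andP[/imsetP[x _ ->] xv].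
by exists x; rewrite // inE rep_covers.
Qed.

Lemma rep_minimal x : minimal x = (#|phi x| == 1).
Proof.
apply/forallP/eqP => [minx|x1 y].
  apply/eqP; apply: contraT => x1.
  have {}x1 : 1 < #|phi x| by have := rep_gt0 x; rewrite rep_rk; nlia.
  have [_ _ low _] := rep_family; have [a [b abx]] := low _ (rep_mem x) x1.
  have [ax _ _ _] := lower_pair_facts abx.
  have [[/imsetP[y _ yE] _ _ _ _] _] := abx.
  by have := minx y; rewrite rep_lt -yE ax.
rewrite rep_lt; apply/negP => /proper_card; rewrite x1 -rep_rk.
by have := rep_gt0 y; nlia.
Qed.

Lemma rep_level_edges r :
  [set phi @: (e : {set P}) | e in level_edges P r] = flevel F r.
Proof.
apply/setP=> e; apply/imsetP/imsetP=> [[e' /imsetP[v]]|[a]].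
  rewrite inE rep_rk => vr -> ->; exists (phi v); last exact: rep_covered.
  by rewrite inE rep_mem.
rewrite inE => /andP[/imsetP[v _ ->] vr] ->.
exists (covered v); last by rewrite rep_covered.
by apply: imset_f; rewrite inE rep_rk.
Qed.

Lemma rep_covered2 v x y : x != y -> covers v x -> covers v y ->
  1 < #|phi v| /\ exists a b, lower_pair F (phi v) a b /\
    ((a, b) = (phi x, phi y) \/ (a, b) = (phi y, phi x)).
Proof.
move=> xy vx vy; have [_ _ low _] := rep_family.
have v1 : 1 < #|phi v|.
  move: vx; rewrite rep_covers => /andP[_ /eqP <-].
  by have := rep_gt0 x; rewrite rep_rk.
split=> //; have [a [b abv]] := low _ (rep_mem v) v1; exists a, b; split=> //.
have in_ z : covers v z -> phi z \in [set a; b].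
  by rewrite rep_covers -(lower_pair_fcov abv) inE rep_mem.
have := in_ _ vx; have := in_ _ vy; rewrite !inE.
have neq : phi x != phi y by rewrite (inj_eq rep_inj).
move=> /orP[]/eqP yE /orP[]/eqP xE; rewrite xE yE ?eqxx // in neq *.
  by right.
by left.
Qed.

Lemma rep_vine : vine P.
Proof.
have [_ _ low forF] := rep_family; split.
- split=> [x y|x y|x].
  + by rewrite rep_lt !rep_rk => /proper_card.
  + by rewrite rep_covers !rep_rk => /andP[_ /eqP].
  + by rewrite rep_minimal rep_rk => /eqP.
- move=> v; rewrite rep_minimal => v1.
  have {}v1 : 1 < #|phi v| by have := rep_gt0 v; rewrite rep_rk; nlia.
  have [a [b abv]] := low _ (rep_mem v) v1.
  have [_ _ ab _] := lower_pair_facts abv.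
  rewrite -(card_imset _ rep_inj) rep_covered (lower_pair_fcov abv) cards2.
  by rewrite ab.
- move=> x y v w xy _ vx vy wx wy.
  have [v1 [a [b [/lower_pair_fcov vE abE]]]] := rep_covered2 xy vx vy.
  have [w1 [a' [b' [/lower_pair_fcov wE abE']]]] := rep_covered2 xy wx wy.
  apply: rep_inj; apply: (fcov_inj rep_family); rewrite ?rep_mem // vE wE.
  by case: abE => -[-> ->]; case: abE' => -[-> ->] //; rewrite setUC.
move=> r /andP[r0 _]; apply/(forest_inj _ rep_inj).
by rewrite rep_level_edges; apply: forF.
Qed.

Lemma rep_R_vine t : (forall x : P, (x <= t)%O) -> R_vine P.
Proof.
move=> top; have [_ F1 low forF] := rep_family.
have rkE : poset_rk P = #|phi t|.
  apply/eqP; rewrite eqn_leq; apply/andP; split.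
    by apply/bigmax_leqP=> x _; rewrite rep_rk subset_leq_card // -rep_le.
  by rewrite -rep_rk; apply: leq_bigmax.
split; first exact: rep_vine.
- rewrite rkE /poset_dim -(card_imset _ rep_inj).
  rewrite -(card_imset (mem (phi t)) set1_inj); apply: eq_card => a.
  apply/imsetP/imsetP=> [[i /= it ->]|[x]].
    have /imsetP[x _ xE] := F1 _ _ (rep_mem t) it.
    by exists x => //; rewrite inE rep_minimal -xE cards1.
  rewrite inE rep_minimal => /cards1P[i xi] ->; exists i => //=.
  by rewrite -sub1set -xi -rep_le.
- move=> r /[dup] /andP[r0 _]; rewrite rkE => rt; split.
  + have [w /imsetP[x _ ->] [_ wr]] := fam_subset_card rep_family (rep_mem t) rt.
    by apply/set0Pn; exists x; rewrite inE rep_rk wr.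
  + apply/(forest_inj _ rep_inj).
    by rewrite rep_level_edges; apply: forF.
  + move=> x y; rewrite !inE !rep_rk => /eqP xr /eqP yr.
    apply: (@connect_inj _ _ _ (level_edges P r)) rep_inj _.
    rewrite rep_level_edges.
    apply: connect_adjS (fbelow_level F (phi t) r) _ _ _.
    by rewrite -xr; apply: (fam_connect rep_family);
      rewrite ?rep_mem -?rep_le ?top // xr yr.
move=> x y xy rkxy; rewrite rep_rk => x2 [v /andP[vx vy]].
have [v1 [a [b [abv abE]]]] := rep_covered2 xy vx vy.
have [_ _ _ cab] := lower_pair_facts abv; have [_ [abF _]] := abv.
have : phi x :&: phi y \in F /\ #|phi x :&: phi y|.+2 = #|phi v|.
  have v2 : 2 < #|phi v|.
    by move: vx; rewrite rep_covers => /andP[_ /eqP <-].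
  by case: abE abF cab => -[-> ->] /(_ v2); rewrite 1?setIC.
case=> /imsetP[z _ zE] cz; exists z; rewrite !rep_covers -zE subsetIl subsetIr /=.
by move: vx vy; rewrite !rep_covers => /andP[_ /eqP cx] /andP[_ /eqP cy]; nlia.
Qed.

End Representation.

Lemma rep_ideal (P : rposet) (V : finType) (phi : P -> {set V}) (v : P) :
  represents phi ->
  represents (fun x : principal_ideal v => phi (ideal_val x)).
Proof.
move=> repP; split=> [x y|x|].
- by rewrite -(rep_le repP).
- exact: rep_rk repP _.
suff -> : [set phi (ideal_val x) | x in [set: principal_ideal v]] =
    [set u in phi @: [set: P] | u \subset phi v].
  exact/lr_family_below/rep_family.
apply/setP=> a; rewrite inE; apply/imsetP/andP=> [[x _ ->]|[/imsetP[x _ ->]]].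
  by rewrite imset_f // -(rep_le repP) ideal_valP.
by rewrite -(rep_le repP) => xv; exists (Ideal xv).
Qed.

Lemma rep_LR_vine (P : rposet) (V : finType) (phi : P -> {set V}) :
  represents phi -> LR_vine P.
Proof.
move=> repP; split=> [|v]; first exact: rep_vine repP.
apply: (rep_R_vine (rep_ideal v repP)) (Ideal (lexx v)) _ => x.
exact: ideal_valP.
Qed.

Section MinimalElementsBelow.

Variable P : rposet.
Implicit Types (x y z v w : P).

Definition minima x : {set min_elt P} := [set i | (min_val i <= x)%O].

Hypothesis grP : graded P.

Lemma exists_minimal x : exists i : min_elt P, (min_val i <= x)%O.
Proof.
have [rk_lt _ _] := grP.
case: (@arg_minnP _ x (fun y => (y <= x)%O) (fun y => rk y) (lexx x)) => y yx ymin.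
suff miny : minimal y by exists (MinElt miny).
apply/forallP=> z; apply/negP=> zy.
by have := ymin z (le_trans (ltW zy) yx); rewrite leqNgt rk_lt.
Qed.

Lemma exists_covered x y : (x < y)%O -> exists2 z, covers y z & (x <= z)%O.
Proof.
have [rk_lt _ _] := grP => xy; pose D := [pred z | (x <= z)%O && (z < y)%O].
have Dx : D x by rewrite /= lexx.
case: (@arg_maxnP _ x D (fun y => rk y) Dx) => z /= /andP[xz zy] zmax.
exists z => //; rewrite /covers zy; apply/forallP=> w; apply/negP=> /andP[zw wy].
have := zmax w; rewrite /= wy (le_trans xz (ltW zw)) => /(_ isT).
by rewrite leqNgt rk_lt.
Qed.

Lemma graded_rk_gt0 x : 0 < rk x.
Proof.
have [rk_lt _ rk_min] := grP; have [i] := exists_minimal x.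
rewrite le_eqVlt => /orP[/eqP <-|/rk_lt]; last exact: leq_ltn_trans.
by rewrite (rk_min _ (min_valP i)).
Qed.

Lemma graded_minimal x : minimal x = (rk x == 1).
Proof.
have [rk_lt _ rk_min] := grP; apply/idP/eqP=> [/rk_min //|x1].
apply/forallP=> y; apply/negP=> /rk_lt; rewrite x1.
by have := graded_rk_gt0 y; nlia.
Qed.

Lemma minimaS x y : (x <= y)%O -> minima x \subset minima y.
Proof. by move=> xy; apply/subsetP=> i; rewrite !inE => /le_trans; apply. Qed.

Lemma minima_min i : minima (min_val i) = [set i].
Proof.
apply/setP=> j; rewrite !inE; apply/idP/eqP=> [|-> //].
rewrite le_eqVlt => /orP[/eqP/val_inj //|ji].
by have /forallP/(_ (min_val j)) := min_valP i; rewrite ji.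
Qed.

Lemma ideal_covers y (a b : principal_ideal y) :
  covers b a = covers (ideal_val b) (ideal_val a).
Proof.
rewrite /covers; congr (_ && _); apply/forallP/forallP=> noz z; last exact: (noz (ideal_val z)).
apply/negP=> /andP[az zb].
have zy : (z <= y)%O by apply: le_trans (ltW zb) (ideal_valP b).
by have /negP[] := noz (Ideal zy); apply/andP; split.
Qed.

Lemma ideal_minimal y (a : principal_ideal y) : minimal a = minimal (ideal_val a).
Proof.
apply/forallP/forallP=> noz z; last exact: (noz (ideal_val z)).
apply/negP=> za.
have zy : (z <= y)%O by apply: le_trans (ltW za) (ideal_valP a).
by have /negP[] := noz (Ideal zy).
Qed.

Lemma ideal_covered y (a : principal_ideal y) :
  (@ideal_val P y) @: covered a = covered (ideal_val a).
Proof.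
apply/setP=> z; apply/imsetP/idP=> [[b]|].
  by rewrite inE ideal_covers => ba ->; rewrite inE.
rewrite inE => az; have zy : (z <= y)%O.
  by apply: le_trans (ideal_valP a); case/andP: az => /ltW.
by exists (Ideal zy); rewrite // inE ideal_covers.
Qed.

Lemma ideal_rk y : poset_rk (principal_ideal y) = rk y.
Proof.
have [rk_lt _ _] := grP; apply/eqP; rewrite eqn_leq; apply/andP; split.
  apply/bigmax_leqP=> z _; have := ideal_valP z; rewrite le_eqVlt /rk /=.
  by case/orP=> [/eqP->|/rk_lt/ltnW].
exact: (@leq_bigmax _ (fun z : principal_ideal y => rk z) (Ideal (lexx y))).
Qed.

Lemma ideal_dim y : poset_dim (principal_ideal y) = #|minima y|.
Proof.
rewrite /poset_dim -(card_imset _ (@val_inj _ _ (ideal y))).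
rewrite -(card_imset (minima y) val_inj); apply: eq_card => x.
apply/imsetP/imsetP=> [[z]|[i]].
  rewrite inE ideal_minimal => mz ->; exists (MinElt mz) => //.
  by rewrite inE; apply: ideal_valP.
rewrite inE => iy ->; exists (Ideal iy) => //.
by rewrite inE ideal_minimal; apply: min_valP.
Qed.

End MinimalElementsBelow.

Section MinsetRepresentation.

Variable P : rposet.
Hypothesis LRP : LR_vine P.
Implicit Types (x y z v w : P).
Let grP : graded P. Proof. by case: LRP => -[]. Qed.

Lemma card_minima x : #|minima x| = rk x.
Proof.
have [_ /(_ x)[_ rk_dim _ _]] := LRP.
by rewrite -ideal_dim // -rk_dim ideal_rk.
Qed.

Lemma covers_of_covered x a b : covered x = [set a; b] -> covers x a /\ covers x b.
Proof.
move=> /setP E; have := E a; have := E b.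
by rewrite !inE !eqxx orbT => -> ->.
Qed.

Lemma vine_covered2 x : ~~ minimal x -> exists a b,
  [/\ a != b, covered x = [set a; b], rk x = (rk a).+1 & rk x = (rk b).+1].
Proof.
have [[_ c2 _ _] _] := LRP; have [_ rk_cov _] := grP.
move=> /c2/eqP/cards2P[a [b [ab E]]].
have [xa xb] := covers_of_covered E.
by exists a, b; split=> //; apply: rk_cov.
Qed.

Lemma rk_le_poset x : rk x <= poset_rk P.
Proof. exact: (@leq_bigmax _ (fun x : P => rk x)). Qed.

Lemma minima_le x y : (x <= y)%O = (minima x \subset minima y).
Proof.
have [[_ _ uni forF] idR] := LRP; have [rk_lt _ _] := grP.
apply/idP/idP=> [|sxy]; first exact: minimaS.
have [n] := ubnP (rk x); elim: n x sxy => // n IH x sxy; rewrite ltnS => xn.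
have [mx|nmx] := boolP (minimal x).
  by have /subsetP/(_ (MinElt mx)) := sxy; rewrite !inE; apply.
have [a [b [ab E ra rb]]] := vine_covered2 nmx.
have [xa xb] := covers_of_covered E.
have below z : covers x z -> rk z < n -> (z <= y)%O.
  move=> /andP[/ltW zx _] zn; apply: IH zn.
  exact: subset_trans (minimaS zx) sxy.
have ay : (a <= y)%O by apply: below => //; rewrite -ra in xn *; nlia.
have by_ : (b <= y)%O by apply: below => //; rewrite -rb in xn *; nlia.
apply: contraT => nxy.
have r0 : 0 < rk a by apply: graded_rk_gt0.
have rE : rk a = rk b by move: ra; rewrite rb => -[].
have abF : [set a; b] \in level_edges P (rk a).
  by rewrite -E; apply: imset_f; rewrite inE ra.
have for_a : forest (level_edges P (rk a)) by apply: forF; rewrite r0 rk_le_poset.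
have /negP[] := forest_bridge for_a ab abF.
have [_ _ treeI _] := idR y.
have [|_ _ conI] := treeI (rk a).
  rewrite r0 ideal_rk //=; move: ay; rewrite le_eqVlt.
  by case/predU1P=> [->|/rk_lt/ltnW].
have := conI (Ideal ay) (Ideal by_); rewrite !inE /= eqxx -rE eqxx => /(_ isT isT).
have lift (s t : principal_ideal y) :
    adj (level_edges (principal_ideal y) (rk a)) s t ->
    adj (level_edges P (rk a) :\ [set a; b]) (ideal_val s) (ideal_val t).
  rewrite /adj /= => /imsetP[w]; rewrite inE => wr wE.
  have wE' : [set ideal_val s; ideal_val t] = covered (ideal_val w).
    by rewrite -ideal_covered // -wE imsetU1 imset_set1.
  rewrite wE' in_setD1 imset_f ?inE // andbT.
  apply: contra nxy => /eqP/covers_of_covered[wa wb].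
  by rewrite (uni a b x (ideal_val w)) //; apply: ideal_valP.
case/connectP=> p pP bE; apply/connectP; exists (map (@ideal_val P y) p).
  have : path (relpre (@ideal_val P y) (adj (level_edges P (rk a) :\ [set a; b])))
      (Ideal ay) p by apply: sub_path pP.
  by rewrite -path_map.
by rewrite -[a]/(ideal_val (Ideal ay)) last_map -bE.
Qed.

Lemma minima_inj : injective (@minima P).
Proof. by move=> x y E; apply/le_anti; rewrite !minima_le E subxx. Qed.

Lemma minima_fcov v :
  fcov (@minima P @: [set: P]) (minima v) = @minima P @: covered v.
Proof.
have [rk_lt rk_cov _] := grP.
apply/setP=> a; apply/idP/imsetP=> [|[x]].
  rewrite inE => /and3P[/imsetP[x _ ->]]; rewrite -minima_le !card_minima => xv cxv.
  exists x => //; rewrite inE /covers lt_neqAle xv andbT; apply/andP; split.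
    by apply: contraTneq cxv => ->; nlia.
  by apply/forallP=> z; apply/negP=> /andP[/rk_lt + /rk_lt]; rewrite -(eqP cxv); nlia.
rewrite inE => /[dup] /rk_cov rv /andP[/ltW xv _] ->.
by rewrite inE imset_f // -minima_le xv !card_minima rv eqxx.
Qed.

Lemma minima_family : lr_family (@minima P @: [set: P]).
Proof.
have [[_ _ _ forF] idR] := LRP; have [rk_lt rk_cov _] := grP.
split.
- apply/imsetP=> -[x _ /esym/eqP]; apply/negP/set0Pn.
  by have [i ix] := exists_minimal grP x; exists i; rewrite inE.
- by move=> _ i _ _; rewrite -minima_min imset_f.
- move=> _ /imsetP[x _ ->]; rewrite card_minima => x1.
  have nmx : ~~ minimal x by rewrite graded_minimal //; nlia.
  have [a [b [ab E ra rb]]] := vine_covered2 nmx.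
  have [xa xb] := covers_of_covered E.
  have ax : (a <= x)%O by case/andP: xa => /ltW.
  have bx : (b <= x)%O by case/andP: xb => /ltW.
  have low t : (t < x)%O -> (t <= a)%O || (t <= b)%O.
    move=> /(exists_covered grP)[z xz tz].
    have : z \in covered x by rewrite inE.
    by rewrite E !inE => /orP[]/eqP <-; rewrite tz ?orbT.
  have U : minima a :|: minima b = minima x.
    apply/eqP; rewrite eqEsubset subUset !minimaS //=; apply/subsetP=> i.
    rewrite !inE => ix; apply: low; rewrite lt_neqAle ix andbT.
    by apply: contraNneq nmx => <-; apply: min_valP.
  exists (minima a), (minima b); split; first by rewrite !imset_f // !card_minima.
  split=> [|_ /imsetP[t _ ->]]; last first.
    by rewrite properE -!minima_le -[_ && _]/(_ && ~~ _) -lt_leAnge; apply: low.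
  rewrite card_minima => x2; have [_ _ _ prox] := idR x.
  have [||||z /andP[]] := prox (Ideal ax) (Ideal bx).
  + by rewrite -(inj_eq val_inj).
  + by rewrite /rk /=; nlia.
  + by rewrite /rk /=; nlia.
  + by exists (Ideal (lexx x)); rewrite !ideal_covers /= xa.
  rewrite !ideal_covers /= => az bz; suff <- : minima (ideal_val z) = minima a :&: minima b.
    exact: imset_f.
  apply/eqP; rewrite eqEcard subsetI !minimaS /=; last 2 first.
  + by case/andP: bz => /ltW.
  + by case/andP: az => /ltW.
  have := cardsUI (minima a) (minima b); rewrite U !card_minima.
  have az' := rk_cov _ _ az; rewrite ra az' in rb *; move: rb.
  rewrite (rk_cov _ _ bz) => _.
  by move: #|_ :&: _| (rk _) => m n; nlia.
move=> r r0; have E : flevel (@minima P @: [set: P]) r =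
    [set @minima P @: (e : {set P}) | e in level_edges P r].
  apply/setP=> e; apply/imsetP/imsetP=> [[a]|[_ /imsetP[v + ->] ->]].
    rewrite inE => /andP[/imsetP[v _ ->]]; rewrite card_minima => vr ->.
    exists (covered v); last exact: minima_fcov.
    by apply: imset_f; rewrite inE.
  rewrite inE => vr; exists (minima v); last by rewrite minima_fcov.
  by rewrite inE imset_f // card_minima.
rewrite E; apply/(forest_inj _ minima_inj).
have [rP|Pr] := leqP r (poset_rk P); first by apply: forF; rewrite r0.
apply: forestS (@forest0 P); apply/subsetP=> e /imsetP[v].
rewrite inE => /eqP vr _.
by have := rk_le_poset v; nlia.
Qed.

Lemma minima_represents : represents (@minima P).
Proof.
split; [exact: minima_le|by move=> x; rewrite card_minima|exact: minima_family].
Qed.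

End MinsetRepresentation.

(** * Principal cliques of MAT-labeled graphs *)

Section MATGraphs.
Variable G : elgraph.
Hypothesis matG : MAT_labeling G.
Implicit Types (e f : {set G}) (i j h a b : G) (u v w : {set G}) (k r : nat).

Local Notation K := principal_clique.

Lemma edge_neq i j : [set i; j] \in edges G -> i != j.
Proof.
move=> /card_edge ij2; apply/eqP=> ij.
by move: ij2; rewrite ij setUid cards1.
Qed.

Lemma edgeP e : e \in edges G -> exists i j, i != j /\ e = [set i; j].
Proof. by move=> /card_edge/eqP/cards2P[i [j []]]; exists i, j. Qed.

Lemma cond_verticesP i j h : reflect
  [/\ [set i; h] \in edges G, label [set i; h] < label [set i; j],
      [set j; h] \in edges G & label [set j; h] < label [set i; j]]
  (h \in cond_vertices [set i; j]).
Proof.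
rewrite inE; apply: (iffP forall_inP) => [H|[? ? ? ?] u].
  have /andP[-> ->] := H i (set21 _ _).
  by have /andP[-> ->] := H j (set22 _ _).
by rewrite !inE => /orP[]/eqP->; apply/andP.
Qed.

Lemma cond_vertices_notin e h : h \in e -> h \notin cond_vertices e.
Proof.
move=> he; rewrite inE; apply/negP => /forall_inP/(_ h he)/andP[/edge_neq].
by rewrite eqxx.
Qed.

Lemma card_cond_vertices e : e \in edges G -> #|cond_vertices e| = (label e).-1.
Proof.
move=> eE; have [_] := matG (label_gt0 eE); apply.
by rewrite inE eE eqxx.
Qed.

Lemma card_principal_clique e : e \in edges G -> #|K e| = (label e).+1.
Proof.
move=> eE; rewrite cardsU card_edge // card_cond_vertices //.
suff -> : e :&: cond_vertices e = set0.
  by rewrite cards0 subn0; case: (label e) (label_gt0 eE).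
apply/setP=> h; rewrite in_set0 in_setI; apply/andP=> -[he].
by apply/negP/cond_vertices_notin.
Qed.

Lemma edge_sub_clique e : e \subset K e.
Proof. exact: subsetUl. Qed.

Definition cliques_below k : {set {set G}} :=
  [set [set i] | i in [set: G]] :|:
  [set K e | e in edges G & label e < k].

Lemma cliques_belowP k v : reflect
  ((exists i, v = [set i]) \/
   (exists e, [/\ e \in edges G, label e < k & v = K e]))
  (v \in cliques_below k).
Proof.
rewrite in_setU; apply: (iffP orP) => -[].
- by case/imsetP=> i _ ->; left; exists i.
- by case/imsetP=> e; rewrite inE => /andP[? ?] ->; right; exists e.
- by case=> i ->; left; apply: imset_f.
- by case=> e [? ? ->]; right; apply: imset_f; rewrite inE; apply/andP.
Qed.

Lemma cliques_below_big k v : v \in cliques_below k -> 1 < #|v| ->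
  exists e, [/\ e \in edges G, label e < k & v = K e].
Proof. by case/cliques_belowP=> [[i ->]|//]; rewrite cards1. Qed.

Lemma cliques_belowS k v :
  v \in cliques_below k -> v \in cliques_below k.+1.
Proof.
case/cliques_belowP=> [[i ->]|[e [eE ek ->]]]; apply/cliques_belowP.
  by left; exists i.
by right; exists e; split=> //; apply: ltnW.
Qed.

Lemma cliques_below_card k v : 0 < k ->
  (v \in cliques_below k) = (v \in cliques_below k.+1) && (#|v| <= k).
Proof.
move=> k0; apply/idP/andP=> [vk|[]].
  split; first exact: cliques_belowS.
  case/cliques_belowP: vk => [[i ->]|[e [eE ek ->]]]; first by rewrite cards1.
  by rewrite card_principal_clique.
case/cliques_belowP=> [[i ->]|[e [eE _ ->]]] vk; apply/cliques_belowP.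
  by left; exists i.
by rewrite card_principal_clique // in vk; right; exists e.
Qed.

Lemma cliques_below_cardS k v : 0 < k -> v \in cliques_below k.+1 -> #|v| <= k.+1.
Proof. by move=> k0; rewrite cliques_below_card // => /andP[]. Qed.

Definition clique_invariant k : Prop :=
  [/\ lr_family (cliques_below k),
      forall e a b, e \in edges G -> label e < k -> a \in K e -> b \in K e ->
        a != b -> [set a; b] \in edges G /\
        ([set a; b] = e \/ label [set a; b] < label e)
    & forall e u, e \in edges G -> label e < k -> u \in cliques_below k ->
        e \subset u -> K e \subset u].

Lemma clique_invariant1 : clique_invariant 1.
Proof.
have no e : e \in edges G -> label e < 1 -> False.
  by move=> /label_gt0; rewrite ltnS leqn0 lt0n => /negP.
have single v : v \in cliques_below 1 -> exists i, v = [set i].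
  by case/cliques_belowP=> [//|[e [/no e0 /e0]]].
split; [|by move=> e a b /no e0 /e0|by move=> e u /no e0 /e0].
split.
- by apply/negP=> /single[i /esym/eqP]; apply/negP/set0Pn; exists i; rewrite set11.
- by move=> u i _ _; apply/cliques_belowP; left; exists i.
- by move=> v /single[i ->]; rewrite cards1.
move=> r r0; apply: forestS (@forest0 _); apply/subsetP=> e /imsetP[v].
rewrite inE => /andP[/single[i ->]]; rewrite cards1 => /eqP; nlia.
Qed.

Section Step.
Variable k : nat.
Hypothesis k_gt0 : 0 < k.
Hypothesis inv_k : clique_invariant k.

Let F := cliques_below k.
Let lrF : lr_family F. Proof. by case: inv_k. Qed.

Lemma bounded_edge a b u : a != b -> u \in F -> a \in u -> b \in u ->
  [set a; b] \in edges G /\ label [set a; b] < k.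
Proof.
have [_ I2 _] := inv_k => ab uF au bu.
have u1 : 1 < #|u|.
  by apply: leq_trans (subset_leq_card (_ : [set a; b] \subset u));
    [rewrite cards2 ab | apply/sub2P].
have [e [eE ek uE]] := cliques_below_big uF u1; rewrite uE in au bu.
have [abE [->|abe]] := I2 e a b eE ek au bu ab; first by rewrite eE.
by rewrite abE; split=> //; apply: ltn_trans abe ek.
Qed.

Lemma edge_bounded a b : [set a; b] \in edges G -> label [set a; b] < k ->
  exists u, [/\ u \in F, a \in u & b \in u].
Proof.
move=> abE abk; exists (K [set a; b]).
have /sub2P[? ?] := edge_sub_clique [set a; b]; split=> //.
by apply/cliques_belowP; right; exists [set a; b].
Qed.

Section NewClique.
Variables i j : G.
Hypothesis ijE : [set i; j] \in edges G.
Hypothesis ijk : label [set i; j] = k.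
Let H := cond_vertices [set i; j].

Lemma new_clique_unbounded u : u \in F -> i \in u -> j \notin u.
Proof.
move=> uF iu; apply/negP=> ju.
by have [_] := bounded_edge (edge_neq ijE) uF iu ju; rewrite ijk ltnn.
Qed.

Lemma cond_bounded h h' : h \in H -> h' \in H ->
  exists u, [/\ u \in F, h \in u & h' \in u].
Proof.
move=> /cond_verticesP[]; rewrite ijk => ih ihk jh jhk.
move=> /cond_verticesP[]; rewrite ijk => ih' ihk' jh' jhk'.
have [u [uF iu hu]] := edge_bounded ih ihk; have [v [vF jv hv]] := edge_bounded jh jhk.
have [w [wF jw hw]] := edge_bounded jh' jhk'; have [z [zF iz hz]] := edge_bounded ih' ihk'.
have [hh'|hh'] := eqVneq h h'; first by exists u; rewrite -hh'.
have U : uniq [:: i; h; j; h'].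
  rewrite /= !inE !negb_or (edge_neq ih) (edge_neq ijE) (edge_neq ih') hh'.
  by rewrite eq_sym (edge_neq jh) (edge_neq jh').
have [t tF] := fam_square lrF U uF vF wF zF iu hu hv jv jw hw hz iz.
case/orP=> /sub2P[it ht]; last by exists t.
by have := new_clique_unbounded tF it; rewrite ht.
Qed.

Lemma new_clique_half : i |: H \in F /\ #|i |: H| = k.
Proof.
have iH : i \notin H by apply: cond_vertices_notin; rewrite set21.
have cH : #|i |: H| = k.
  rewrite cardsU1 iH card_cond_vertices // ijk add1n prednK //.
split=> //; have [||v vF sv] := fam_clique lrF (_ : i |: H != set0).
- by apply/set0Pn; exists i; rewrite setU11.
- have bi h : h \in H -> exists u, [/\ u \in F, i \in u & h \in u].
    by case/cond_verticesP; rewrite ijk => ih ihk _ _; apply: edge_bounded.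
  move=> a b; rewrite !in_setU1 => /predU1P[->|aH] /predU1P[->|bH].
  + exists [set i]; last by apply/sub2P; rewrite set11.
    by apply/cliques_belowP; left; exists i.
  + by have [u [? ? ?]] := bi _ bH; exists u => //; apply/sub2P.
  + by have [u [? ? ?]] := bi _ aH; exists u => //; apply/sub2P.
  + by have [u [? ? ?]] := cond_bounded aH bH; exists u => //; apply/sub2P.
suff /eqP -> : i |: H == v by [].
by rewrite eqEcard sv cH; move: vF; rewrite /F cliques_below_card // => /andP[].
Qed.

End NewClique.

Lemma new_clique i j : [set i; j] \in edges G -> label [set i; j] = k ->
  let H := cond_vertices [set i; j] in
  [/\ K [set i; j] = (i |: H) :|: (j |: H), (i |: H) :&: (j |: H) = H,
      i \notin H, j \notin H &
      [/\ i |: H \in F, j |: H \in F, #|i |: H| = k, #|j |: H| = k &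
          1 < k -> H \in F]].
Proof.
move=> ijE ijk H; have [iF ci] := new_clique_half ijE ijk.
have [jF cj] : j |: H \in F /\ #|j |: H| = k.
  by rewrite /H (setUC [set i] [set j]); apply: new_clique_half; rewrite setUC.
have iH : i \notin H by apply: cond_vertices_notin; rewrite set21.
have jH : j \notin H by apply: cond_vertices_notin; rewrite set22.
have IE : (i |: H) :&: (j |: H) = H.
  rewrite -setUIl; suff -> : [set i] :&: [set j] = set0 by rewrite set0U.
  apply/setP=> h; rewrite in_setI !in_set1 in_set0; apply/andP=> -[/eqP->].
  by rewrite (negPf (edge_neq ijE)).
split=> //; first by rewrite setUACA setUid.
split=> // k1; rewrite -IE; apply: fam_inter => //; rewrite IE -card_gt0.
by rewrite card_cond_vertices // ijk -subn1 subn_gt0.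
Qed.

Lemma new_clique_pairs i j a b : [set i; j] \in edges G -> label [set i; j] = k ->
  a \in K [set i; j] -> b \in K [set i; j] -> a != b ->
  [set a; b] = [set i; j] \/
  ([set a; b] \subset i |: cond_vertices [set i; j]) ||
  ([set a; b] \subset j |: cond_vertices [set i; j]).
Proof.
move=> ijE ijk; have [-> _ _ _ _] := new_clique ijE ijk.
rewrite !subUset !sub1set !in_setU !in_set1 => aK bK ab.
case/orP: aK => /orP[/eqP->|aH]; case/orP: bK => /orP[/eqP->|bH];
  rewrite ?eqxx ?aH ?bH ?orbT; try by right.
- by left.
- by left; rewrite setUC.
Qed.

Lemma step_pairs e a b : e \in edges G -> label e < k.+1 ->
  a \in K e -> b \in K e -> a != b -> [set a; b] \in edges G /\
    ([set a; b] = e \/ label [set a; b] < label e).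
Proof.
have [_ I2 _] := inv_k => eE; rewrite ltnS leq_eqVlt => /orP[/eqP ek|]; last exact: I2.
have [i [j [ij eij]]] := edgeP eE; rewrite eij in eE ek * => aK bK ab.
have [_ _ _ _ [iF jF _ _ _]] := new_clique eE ek.
have [->|/orP[]/sub2P[aS bS]] := new_clique_pairs eE ek aK bK ab.
- by split=> //; left.
- by have [? ?] := bounded_edge ab iF aS bS; split=> //; right; rewrite ek.
- by have [? ?] := bounded_edge ab jF aS bS; split=> //; right; rewrite ek.
Qed.

Lemma step_sub_new i j f : [set i; j] \in edges G -> label [set i; j] = k ->
  f \in edges G -> label f < k -> f \subset K [set i; j] ->
  (K f \subset i |: cond_vertices [set i; j]) ||
  (K f \subset j |: cond_vertices [set i; j]).
Proof.
have [_ _ I3] := inv_k => ijE ijk fE fk.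
have [a [b [ab fab]]] := edgeP fE; rewrite fab in fE fk * => /sub2P[aK bK].
have [_ _ _ _ [iF jF _ _ _]] := new_clique ijE ijk.
have [E|/orP[]S] := new_clique_pairs ijE ijk aK bK ab.
- by rewrite E ijk ltnn in fk.
- by rewrite I3.
- by rewrite orbC I3.
Qed.

Lemma step_least e u : e \in edges G -> label e < k.+1 ->
  u \in cliques_below k.+1 -> e \subset u -> K e \subset u.
Proof.
have [_ _ I3] := inv_k => eE ek uF eu.
have u1 : 1 < #|u| by rewrite -(card_edge eE) subset_leq_card.
have [f [fE fk uf]] := cliques_below_big uF u1; rewrite uf in eu *.
have [a [b [ab eab]]] := edgeP eE; have : [set a; b] \subset K f by rewrite -eab.
move=> /sub2P[aK bK]; have [_] := step_pairs fE fk aK bK ab.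
rewrite -eab => -[->|ef] //.
move: fk; rewrite ltnS leq_eqVlt => /orP[/eqP fk|fk]; last first.
  apply: I3 => //; first exact: ltn_trans ef fk.
  by apply/cliques_belowP; right; exists f.
have [i [j [ij fij]]] := edgeP fE; rewrite fij in fE fk eu ef *.
have [-> _ _ _ _] := new_clique fE fk.
have := step_sub_new fE fk eE; rewrite -{1}fk => /(_ ef eu)/orP[]S.
  exact: subset_trans S (subsetUl _ _).
exact: subset_trans S (subsetUr _ _).
Qed.

Lemma step_lower_pair i j : [set i; j] \in edges G -> label [set i; j] = k ->
  lower_pair (cliques_below k.+1) (K [set i; j])
    (i |: cond_vertices [set i; j]) (j |: cond_vertices [set i; j]).
Proof.
move=> ijE ijk; have [KE IE _ _ [iF jF ci cj HF]] := new_clique ijE ijk.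
have cK := card_principal_clique ijE; rewrite ijk in cK.
split; first by rewrite ci cj cK KE; split=> //; apply: cliques_belowS.
split=> [|w wF wK].
  by rewrite cK ltnS IE => /HF; apply: cliques_belowS.
have [[a wa]|[f [fE _ wf]]] := cliques_belowP _ _ wF.
  by have := proper_sub wK; rewrite wa KE !sub1set in_setU.
rewrite wf; apply: step_sub_new => //.
  by have := proper_card wK; rewrite wf !card_principal_clique // ijk.
exact: subset_trans (edge_sub_clique f) (eq_ind _ (fun w => w \subset _) (proper_sub wK) _ wf).
Qed.

Lemma step_fcov v : #|v| <= k.+1 -> fcov (cliques_below k.+1) v = fcov F v.
Proof.
move=> vk; apply/setP=> x; rewrite [LHS]in_set [RHS]in_set (cliques_below_card _ k_gt0).
case: (boolP (#|x|.+1 == #|v|)) => [/eqP xv|]; last by rewrite !andbF.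
have xk : #|x| <= k by rewrite -ltnS xv.
by rewrite xk !andbT.
Qed.

Lemma step_top_edge u v : adj (flevel (cliques_below k.+1) k) u v ->
  exists i j, [/\ [set i; j] \in edges G, label [set i; j] = k,
    u = i |: cond_vertices [set i; j] & v = j |: cond_vertices [set i; j]].
Proof.
case/imsetP=> w; rewrite inE => /andP[wF /eqP wk].
have [|e [eE ek wE]] := cliques_below_big wF; first by rewrite wk.
have {}ek : label e = k by move: wk; rewrite wE card_principal_clique // => -[].
have [i [j [ij eij]]] := edgeP eE; rewrite eij in eE ek wE.
have L := step_lower_pair eE ek; have [_ _ neq _] := lower_pair_facts L.
rewrite wE (lower_pair_fcov L) => E.
have uv : u != v.
  apply: contraTneq neq => uv; rewrite uv setUid in E; rewrite negbK.
  have := set21 (i |: cond_vertices [set i; j]) (j |: cond_vertices [set i; j]).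
  have := set22 (i |: cond_vertices [set i; j]) (j |: cond_vertices [set i; j]).
  by rewrite -E !inE => /eqP-> /eqP->.
have : u \in [set u; v] by rewrite set21.
have : v \in [set u; v] by rewrite set22.
rewrite E !inE => /orP[]/eqP vE /orP[]/eqP uE; rewrite ?uE ?vE ?eqxx // in uv *.
  exists j, i; rewrite [[set j; i]]setUC; split=> //.
by exists i, j.
Qed.

Lemma step_forest r : 0 < r -> forest (flevel (cliques_below k.+1) r).
Proof.
move=> r0; have [rk|rk] := eqVneq r k; last first.
  have [_ _ _ /(_ r r0)] := lrF; apply: forestS; apply/subsetP=> e /imsetP[v].
  rewrite inE => /andP[vF /eqP vr] ->; have vk := cliques_below_cardS k_gt0 vF.
  rewrite step_fcov //; apply: imset_f; rewrite inE vr eqxx andbT.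
  by rewrite vr in vk; rewrite /F cliques_below_card // vF vr ltn_neqAle rk -ltnS.
rewrite {}rk in r0 * => c cS; have /andP[c3 Uc] := cS.
rewrite cycle_edges_sub //; apply/negP=> cyc.
have top := fun X (Xc : X \in c) => step_top_edge (next_cycle cyc Xc).
pose H (X : {set G}) := X :&: next c X.
have HP X : X \in c -> exists i j, [/\ [set i; j] \in edges G,
    label [set i; j] = k, X = i |: H X, next c X = j |: H X &
    [/\ i \notin H X, j \notin H X, #|H X|.+1 = k, X \in F & 1 < k -> H X \in F]].
  move=> Xc; have [i [j [ijE ijk XE nXE]]] := top X Xc.
  have [_ IE iH jH [iF _ ci _ HF]] := new_clique ijE ijk.
  have HE : H X = cond_vertices [set i; j] by rewrite /H nXE XE.
  exists i, j; rewrite HE; split=> //; split=> //; last by rewrite XE.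
  by rewrite card_cond_vertices // ijk prednK.
have HX X : X \in c -> H (prev c X) = H X.
  move=> Xc; apply/eqP; apply: contraT => neq.
  have [i [j [_ _ _ _ [_ _ cHX XF HF]]]] := HP X Xc.
  have pXc : prev c X \in c by rewrite mem_prev.
  have [_ [_ [_ _ _ _ [_ _ cpX _ _]]]] := HP (prev c X) pXc.
  have [k1|k1] := leqP k 1.
    have H0 Y : #|H Y|.+1 = k -> H Y = set0 by move=> cY; apply/eqP; rewrite -cards_eq0 -leqn0 -ltnS cY.
    by rewrite (H0 _ cHX) (H0 _ cpX) eqxx in neq.
  have cX Y : Y \in c -> #|Y| = k.
    by move=> /HP[a [b [_ _ YE _ [aH _ cY _ _]]]]; rewrite YE cardsU1 aH.
  have covE Y : Y \in c -> H (prev c Y) != H Y -> fcov F Y = [set H (prev c Y); H Y].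
    move=> Yc neqY; have [_ _ low _] := lrF.
    have [_ [_ [_ _ _ _ [_ _ cHY YF HYF]]]] := HP Y Yc.
    have pYc : prev c Y \in c by rewrite mem_prev.
    have [_ [_ [_ _ _ _ [_ _ cpY pYF HpYF]]]] := HP (prev c Y) pYc.
    have [||x [y L]] := low Y; rewrite ?cX //.
    have inC (Z : {set G}) : Z \in F -> Z \subset Y -> #|Z|.+1 = k -> Z \in [set x; y].
      by move=> ZF ZY cZ; rewrite -(lower_pair_fcov L) inE ZF ZY cZ cX /=.
    rewrite (lower_pair_fcov L).
    have := inC _ (HYF k1) (subsetIl _ _) cHY.
    have pYY : H (prev c Y) \subset Y by rewrite /H next_prev // subsetIr.
    have := inC _ (HpYF k1) pYY cpY; rewrite !in_set2 => /orP[]/eqP E1 /orP[]/eqP E2; rewrite E1 E2 ?eqxx // in neqY *.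
    by rewrite setUC.
  have k1' : 0 < k.-1 by rewrite -ltnS prednK.
  have ck : #|X| = k.-1.+1 by rewrite cX // prednK.
  have /negP[] := fam_bridge lrF XF ck k1' neq (covE X Xc neq).
  rewrite adj_connect_sym; apply: connect_around => // Y Yc YX.
  have [->|neqY] := eqVneq (H (prev c Y)) (H Y); first exact: connect0.
  have [_ [_ [_ _ _ _ [_ _ _ YF _]]]] := HP Y Yc.
  apply: connect1; rewrite /adj /= -covE // in_setD1; apply/andP; split.
    apply: contra YX => /eqP/(fcov_inj lrF) E.
    by rewrite E ?cX.
  apply: imset_f; rewrite in_set; apply/andP; split=> //.
  by rewrite cX // prednK.
have Hc := cycle_const Uc HX.
have [X0 X0c] : exists X0, X0 \in c by case: (c) c3 => // X ? _; exists X; rewrite mem_head.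
have [q qP] : exists q : {set G} -> G, {in c, forall X, X = q X |: H X0 /\ q X \notin H X0}.
  suff [q qP] : exists q : {set G} -> G, forall X, X \in c -> X = q X |: H X0 /\ q X \notin H X0.
    by exists q.
  have [g0 _] : exists g0 : G, True by have [g [_ _]] := HP X0 X0c; exists g.
  apply: (@fin_all_exists _ _ (fun X g => X \in c -> X = g |: H X0 /\ g \notin H X0)) => X.
  have [Xc|] := boolP (X \in c); last by exists g0.
  have [i [_ [_ _ XE _ [iH _ _ _ _]]]] := HP X Xc.
  by exists i => _; rewrite -(Hc X X0 Xc X0c).
have q_uniq X i : X \in c -> X = i |: H X0 -> i \notin H X0 -> q X = i.
  move=> Xc XE iH; have [XE' qH] := qP X Xc.
  have : q X \in X by rewrite {2}XE' setU11.
  by rewrite {2}XE in_setU1 (negPf qH) orbF => /eqP.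
have qcyc : cycle (adj (edges_eq G k)) (map q c).
  rewrite cycle_map; apply: cycle_from_next => // X Xc; rewrite /relpre /=.
  have [i [j [ijE ijk XE nXE [iH jH _ _ _]]]] := HP X Xc.
  rewrite (Hc X X0 Xc X0c) in XE nXE iH jH.
  rewrite (q_uniq X i) // (q_uniq _ j) ?mem_next //.
  by rewrite /adj /= inE ijE ijk eqxx.
have qU : uniq (map q c).
  rewrite map_inj_in_uniq // => X Y Xc Yc qXY.
  by have [-> _] := qP X Xc; have [-> _] := qP Y Yc; rewrite qXY.
have qS : simple_cycle (map q c) by rewrite /simple_cycle qU size_map c3.
have qX0 : q X0 \in map q c by apply: map_f.
have [/(_ [set q X0; next (map q c) (q X0)]) ml1 _] := matG k_gt0.
have e_k : [set q X0; next (map q c) (q X0)] \in edges_le G k.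
  by have := next_cycle qcyc qX0; rewrite /adj /= !in_set => /andP[-> /eqP->] /=.
have /negP[] := ml1 e_k (map q c) qS (imset_f _ qX0).
apply: subset_trans (subD1set _ _) _.
by rewrite cycle_edges_sub.
Qed.

Lemma clique_invariantS : clique_invariant k.+1.
Proof.
split; [|exact: step_pairs|exact: step_least].
have [F0 _ low _] := lrF; split; last exact: step_forest.
- apply: contra F0; rewrite [set0 \in F]cliques_below_card // => ->.
  by rewrite cards0.
- by move=> u i _ _; apply/cliques_belowP; left; exists i.
move=> v vF v1; have [e [eE ek vE]] := cliques_below_big vF v1.
move: ek; rewrite ltnS leq_eqVlt => /orP[/eqP ek|ek].
  have [i [j [ij eij]]] := edgeP eE; rewrite eij in eE ek vE.
  by rewrite vE; do 2!eexists; apply: step_lower_pair.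
have {}vF : v \in F by apply/cliques_belowP; right; exists e.
have [x [y [[xF yF cx cy xy] [xyF lowv]]]] := low v vF v1.
exists x, y; split; first by split=> //; apply: cliques_belowS.
split=> [/xyF/cliques_belowS //|w wF wv].
apply: lowv => //; rewrite /F cliques_below_card // wF /=.
have := proper_card wv; rewrite vE card_principal_clique // => wk.
exact: ltnW (leq_trans wk ek).
Qed.

End Step.

Lemma clique_invariantP k : 0 < k -> clique_invariant k.
Proof.
elim: k => // -[_ _|k IH _]; first exact: clique_invariant1.
by apply: clique_invariantS => //; apply: IH.
Qed.

Lemma psi_family_below : exists2 k, 0 < k &
  [set psi_val v | v in [set: psi_elt G]] = cliques_below k /\
  forall e, e \in edges G -> label e < k.
Proof.
exists (\max_(e in edges G) label e).+1 => //.
have le e : e \in edges G -> label e < (\max_(e in edges G) label e).+1.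
  by move=> eE; rewrite ltnS; apply: leq_bigmax_cond.
split=> //; apply/setP=> v; apply/imsetP/cliques_belowP => [[x _ ->]|H].
  case/orP: (psi_valP x) => /imsetP[]; first by move=> i _ ->; left; exists i.
  by move=> e eE ->; right; exists e; split=> //; apply: le.
suff pv : psi_pred v by exists (PsiElt pv).
case: H => [[i ->]|[e [eE _ ->]]]; apply/orP; [left|right]; exact: imset_f.
Qed.

Lemma psi_represents : represents (@psi_val G : psi_poset G -> {set G}).
Proof.
have [k k0 [E _]] := psi_family_below; split=> //.
by rewrite E; case: (clique_invariantP k0).
Qed.

Lemma principal_clique_pairs e a b : e \in edges G -> a \in K e -> b \in K e ->
  a != b -> [set a; b] \in edges G /\
    ([set a; b] = e \/ label [set a; b] < label e).
Proof.
have [k k0 [_ le]] := psi_family_below => eE.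
by have [_ I2 _] := clique_invariantP k0; apply: I2 => //; apply: le.
Qed.

Lemma principal_clique_least e (u : psi_elt G) : e \in edges G ->
  e \subset psi_val u -> K e \subset psi_val u.
Proof.
have [k k0 [E le]] := psi_family_below => eE.
have [_ _ I3] := clique_invariantP k0; apply: I3 => //; first exact: le.
by rewrite -E; apply: imset_f.
Qed.

End MATGraphs.

(** * The graph of joins of an LR-vine *)

Lemma is_joinP (P : rposet) (x y z : P) : reflect
  [/\ (x <= z)%O, (y <= z)%O &
      forall w, (x <= w)%O -> (y <= w)%O -> (z <= w)%O]
  (is_join x y z).
Proof.
have ub w : [forall t in [set x; y], (t <= w)%O] = (x <= w)%O && (y <= w)%O.
  apply/forall_inP/andP=> [H|[xw yw] t]; last by rewrite !inE => /orP[]/eqP->.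
  by rewrite !H ?set21 ?set22.
rewrite /is_join /is_sup ub; apply: (iffP andP) => [[/andP[xz yz] /forallP H]|[xz yz H]].
  by split=> // w xw yw; have /implyP := H w; rewrite ub xw yw; apply.
by rewrite xz yz; split=> //; apply/forallP=> w; apply/implyP; rewrite ub => /andP[]; apply: H.
Qed.

Lemma sup_of_pair (P : rposet) (i j : min_elt P) z :
  sup_of [set i; j] z = is_join (min_val i) (min_val j) z.
Proof. by rewrite /sup_of imsetU1 imset_set1. Qed.

Lemma omega_labelE (P : rposet) (e : {set min_elt P}) z :
  sup_of e z -> omega_label e = (rk z).-1.
Proof.
rewrite /omega_label => sz; case: pickP => [w sw|/(_ z)]; last by rewrite sz.
suff -> : w = z by [].
case/andP: sz => ubz /forallP/(_ w)/implyP zw.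
case/andP: sw => ubw /forallP/(_ z)/implyP wz.
by apply/le_anti; rewrite zw ?wz.
Qed.

Section OmegaMAT.
Variable P : rposet.
Hypothesis LRP : LR_vine P.
Hypothesis grP : graded P.
Implicit Types (e : {set min_elt P}) (i j h : min_elt P) (x y z : P).

Let G := omega_graph grP.
Let F := @minima P @: [set: P].
Let repP := minima_represents LRP.
Let lrF : lr_family F := rep_family repP.

Lemma sup_ofE e z : sup_of e z = least F e (minima z).
Proof.
have ub w : [forall t in (@min_val P) @: e, (t <= w)%O] = (e \subset minima w).
  apply/forall_inP/subsetP=> [H i ie|H t /imsetP[i ie ->]].
    by rewrite inE H // imset_f.
  by have := H i ie; rewrite inE.
rewrite /sup_of /is_sup ub /least (rep_mem (@minima P) z) /=; congr (_ && _).
apply/forallP/forall_inP => [H u /imsetP[w _ ->]|H w].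
  by have := H w; rewrite ub (minima_le LRP).
by rewrite ub (minima_le LRP) H // (rep_mem (@minima P)).
Qed.

Lemma omega_edgeP e : reflect (#|e| = 2 /\ exists z, least F e (minima z))
  (e \in edges G).
Proof.
rewrite inE; apply: (iffP andP) => -[/eqP e2].
  by case/existsP=> z; rewrite sup_ofE => ez; split=> //; exists z.
by case=> z ez; split=> //; apply/existsP; exists z; rewrite sup_ofE.
Qed.

Lemma omega_label_least e z : least F e (minima z) ->
  label (e : {set G}) = #|minima z|.-1.
Proof. by rewrite -sup_ofE => /omega_labelE; rewrite (card_minima LRP). Qed.

Lemma minima_gt0 z : 0 < #|minima z|.
Proof. by rewrite card_minima // graded_rk_gt0. Qed.

Lemma omega_edge_lt i h z :
  ([set i; h] \in edges G) && (label ([set i; h] : {set G}) < #|minima z|.-1)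
  <-> h != i /\ exists2 a, a \in F & [set i; h] \subset a /\ #|a| < #|minima z|.
Proof.
split=> [/andP[/omega_edgeP[c2 [w L]]]|[hi [a aF [ia az]]]].
  rewrite (omega_label_least L) => lt; split.
    by move: c2; rewrite cards2 eq_sym; case: eqP.
  exists (minima w); first exact: (rep_mem (@minima P)).
  case/leastP: L => _ ? _; split=> //.
  by move: (minima_gt0 w) (minima_gt0 z) lt; nlia.
have [|b L] := fam_least lrF aF ia; first by apply/set0Pn; exists i; rewrite set21.
have /leastP[/imsetP[w _ bE] _ ble] := L; rewrite bE in L ble.
apply/andP; split.
  by apply/omega_edgeP; split; [rewrite cards2 eq_sym hi | exists w].
rewrite (omega_label_least L).
have := subset_leq_card (ble _ aF ia); move: (minima_gt0 w) az; nlia.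
Qed.

Lemma omega_cond_vertices i j z : i != j -> least F [set i; j] (minima z) ->
  cond_vertices ([set i; j] : {set G}) = minima z :\: [set i; j].
Proof.
move=> ij L; apply/setP=> h; apply/idP/idP.
  case/cond_verticesP; rewrite (omega_label_least L) => ihE ihl jhE jhl.
  have [hi ai] := (omega_edge_lt i h z).1 (introT andP (conj ihE ihl)).
  have [hj aj] := (omega_edge_lt j h z).1 (introT andP (conj jhE jhl)).
  by apply/(fam_conditioning lrF h ij L).
case/(fam_conditioning lrF h ij L) => hi hj ai aj.
have /andP[ihE ihl] := (omega_edge_lt i h z).2 (conj hi ai).
have /andP[jhE jhl] := (omega_edge_lt j h z).2 (conj hj aj).
by apply/cond_verticesP; rewrite (omega_label_least L).
Qed.

Lemma omega_principal_clique i j z : i != j -> least F [set i; j] (minima z) ->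
  principal_clique ([set i; j] : {set G}) = minima z.
Proof.
move=> ij L; rewrite /principal_clique (omega_cond_vertices ij L).
case/leastP: L => _ sz _.
by rewrite setDE setUIr setUCr setIT; apply/setUidPr.
Qed.

Lemma omega_MAT : MAT_labeling G.
Proof.
move=> k k0; split=> [e|e].
  rewrite inE => /andP[eE ek] c cS /imsetP[x xc eE']; have /andP[c3 Uc] := cS.
  apply/negP=> /subsetP sub.
  have [_ [z L]] := omega_edgeP _ eE; rewrite (omega_label_least L) in ek.
  have uz : #|minima z| <= k.+1 by move: (minima_gt0 z) ek; nlia.
  have step : cycle [rel s t | (s != x) ==> least_card F k.+1 s t] c.
    apply: cycle_from_next => // s sc; apply/implyP=> sx.
    have : [set s; next c s] \in edges_eq G k.
      apply: sub; rewrite in_setD1; apply/andP; split; last exact: imset_f.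
      rewrite eE'; apply/eqP=> E.
      have : s \in [set x; next c x] by rewrite -E set21.
      have : x \in [set s; next c s] by rewrite E set21.
      rewrite !inE (negPf sx) eq_sym (negPf sx) /= => /eqP xs /eqP sE.
      have := next_neq_prev cS xc.
      by rewrite xs prev_next // -xs -sE eqxx.
    rewrite inE => /andP[/omega_edgeP[_ [w Lw]] /eqP wk].
    apply/existsP; exists (minima w); rewrite Lw /=.
    by rewrite -wk (omega_label_least Lw) prednK // minima_gt0.
  case/rot_to: (xc) => n [|a p] rotc.
    by move: c3; rewrite -(size_rot n) rotc.
  have nx : next c x = a by rewrite -(next_rot n Uc) rotc /= eqxx.
  have U : uniq (x :: a :: p) by rewrite -rotc rot_uniq.
  have xap : x \notin a :: p by case/andP: U.
  apply: (@fam_no_path _ _ lrF k.+1 a (rcons p x) (minima z)).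
  - by rewrite -rcons_cons rcons_uniq xap; case/andP: U.
  - by move: c3; rewrite -(size_rot n) rotc size_rcons.
  - move: step; rewrite -(rot_cycle n) rotc /= => /andP[_].
    rewrite !rcons_path => /andP[pP lP]; apply/andP; split.
      apply: (@sub_in_path _ (predC1 x) _ _ _ _ _ _ pP).
        by move=> s t /= sx _ /implyP; apply.
      by apply/allP=> s sap; rewrite /= ; apply: contraNneq xap => <-.
    apply: (implyP lP); apply: contraNneq xap => <-; exact: mem_last.
  - exact: (rep_mem (@minima P)).
  - exact: uz.
  - by case/leastP: L => _ /subsetP sz _; apply: sz; rewrite eE' nx set22.
  - by rewrite last_rcons; case/leastP: L => _ /subsetP sz _; apply: sz; rewrite eE' set21.
rewrite inE => /andP[/[dup] eE /omega_edgeP[e2 [z L]] /eqP ek].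
have /cards2P[i [j [ij eij]]] : #|e| == 2 by apply/eqP.
rewrite eij in L ek e2 *; rewrite (omega_cond_vertices ij L).
have /leastP[_ sz _] := L.
rewrite cardsD (setIidPr sz) e2 -ek (omega_label_least L).
by rewrite -!subn1 -subnDA.
Qed.

Lemma omega_psi_family : [set psi_val v | v in [set: psi_elt G]] = F.
Proof.
apply/setP=> v; apply/imsetP/imsetP=> [[x _ ->]|[z _ ->]].
  case/orP: (psi_valP x) => /imsetP[i]; first by move=> _ ->; exists (min_val i); rewrite ?minima_min.
  move=> /[dup] /card_edge/eqP/cards2P[a [b [ab ->]]] /omega_edgeP[_ [z L]] ->.
  by exists z => //; apply: omega_principal_clique.
suff pz : psi_pred (minima z : {set G}) by exists (PsiElt pz).
have [z1|z1] := leqP #|minima z| 1.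
  have : minimal z.
    by rewrite graded_minimal // -card_minima // eqn_leq z1 minima_gt0.
  move=> mz; rewrite -[z]/(min_val (MinElt mz)) minima_min.
  by apply/orP; left; apply: imset_f.
have [i [j [ij L _]]] := fam_pair lrF (rep_mem (@minima P) z) z1.
rewrite -(omega_principal_clique ij L); apply/orP; right; apply: imset_f.
by apply/omega_edgeP; split; [rewrite cards2 ij | exists z].
Qed.

End OmegaMAT.

(** * The equivalence *)

Lemma iso_rank_join_preserving (P P' : rposet) (f : {ffun P -> P'}) :
  (forall x y, (f x <= f y)%O = (x <= y)%O) -> (forall y, exists x, f x = y) ->
  (forall x, rk (f x) = rk x) -> rank_join_preserving f.
Proof.
move=> fle fsurj frk; apply/rank_join_preservingP; split=> // [x y|x y z].
  by rewrite fle.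
case/is_joinP=> xz yz zle; apply/is_joinP; rewrite !fle; split=> // w.
by have [t <-] := fsurj w; rewrite !fle; apply: zle.
Qed.

Section PsiMap.
Variables G G' : elgraph.
Hypotheses (matG : MAT_labeling G) (matG' : MAT_labeling G').
Variable s : lphom G G'.
Implicit Types (i j : G) (e : {set G}).

Lemma lphom_edge i j : [set i; j] \in edges G ->
  [set s i; s j] \in edges G' /\ label [set s i; s j] = label [set i; j].
Proof.
move=> ijE; have /'forall_forallP/(_ i j)/implyP/(_ ijE) := lphomP s.
by case/andP=> ? /eqP.
Qed.

Lemma lphom_inj_psi (v : psi_elt G) : {in psi_val v &, injective s}.
Proof.
move=> i j iv jv sij; apply/eqP; apply: contraT => ij.
case/orP: (psi_valP v) => /imsetP[k kE vE]; rewrite vE in iv jv.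
  by move: iv jv ij; rewrite !inE => /eqP-> /eqP->; rewrite eqxx.
have [/lphom_edge[/edge_neq + _] _] := principal_clique_pairs matG kE iv jv ij.
by rewrite sij eqxx.
Qed.

Lemma lphom_principal_clique i j : [set i; j] \in edges G ->
  s @: principal_clique [set i; j] = principal_clique [set s i; s j].
Proof.
move=> ijE; have [sijE sijl] := lphom_edge ijE.
have pv : psi_pred (principal_clique [set i; j]) by apply/orP; right; apply: imset_f.
apply/eqP; rewrite eqEcard; apply/andP; split.
  apply/subsetP=> _ /imsetP[h hK ->]; move: hK; rewrite !in_setU.
  case/orP=> [|/cond_verticesP[ihE ihl jhE jhl]].
    by rewrite !in_set1 => /orP[]/eqP->; rewrite eqxx ?orbT.
  have [sihE sihl] := lphom_edge ihE; have [sjhE sjhl] := lphom_edge jhE.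
  by apply/orP; right; apply/cond_verticesP; rewrite sihl sjhl sijl.
rewrite card_in_imset; last exact: (@lphom_inj_psi (PsiElt pv)).
by rewrite !card_principal_clique // sijl.
Qed.

Lemma psi_map_pred (v : psi_elt G) : psi_pred (s @: psi_val v).
Proof.
case/orP: (psi_valP v) => /imsetP[k kE ->]; apply/orP.
  by left; rewrite imset_set1; apply: imset_f.
right; have [i [j [_ kij]]] := edgeP kE; rewrite kij in kE *.
rewrite lphom_principal_clique //; apply: imset_f.
by have [] := lphom_edge kE.
Qed.

Definition psi_map : {ffun psi_poset G -> psi_poset G'} :=
  [ffun v : psi_poset G => PsiElt (psi_map_pred v) : psi_poset G'].

Lemma psi_mapE v : psi_val (psi_map v) = s @: psi_val v.
Proof. by rewrite ffunE. Qed.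

Lemma psi_map_lift (z : psi_elt G) (t : psi_elt G') :
  psi_val t \subset s @: psi_val z ->
  exists2 u : psi_elt G, psi_val u \subset psi_val z & s @: psi_val u = psi_val t.
Proof.
case/orP: (psi_valP t) => /imsetP[k kE ->].
  rewrite sub1set => /imsetP[i iz ->].
  have pi : psi_pred [set i] by apply/orP; left; apply: imset_f.
  by exists (PsiElt pi); rewrite /= ?sub1set ?imset_set1.
have [i' [j' [ij' kij]]] := edgeP kE; rewrite kij in kE *.
move=> /(subset_trans (edge_sub_clique _))/sub2P.
case=> /imsetP[i iz si] /imsetP[j jz sj]; rewrite si sj in kE ij' *.
have ij : i != j by apply: contraNneq ij' => ->.
have ijE : [set i; j] \in edges G.
  case/orP: (psi_valP z) => /imsetP[f fE zE]; rewrite zE in iz jz.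
    by move: iz jz ij; rewrite !inE => /eqP-> /eqP->; rewrite eqxx.
  by have [] := principal_clique_pairs matG fE iz jz ij.
have pij : psi_pred (principal_clique [set i; j]) by apply/orP; right; apply: imset_f.
exists (PsiElt pij); last exact: lphom_principal_clique.
by apply: principal_clique_least => //; apply/sub2P.
Qed.

Lemma psi_map_rank_join : rank_join_preserving psi_map.
Proof.
have leE (H : elgraph) (x y : psi_poset H) : (x <= y)%O = (psi_val x \subset psi_val y) by [].
apply/rank_join_preservingP; split=> [x y|x|x y z].
- by rewrite !leE !psi_mapE => /imsetS.
- by rewrite /rk /= psi_mapE card_in_imset //; apply: lphom_inj_psi.
case/is_joinP=> xz yz zle; apply/is_joinP; rewrite !leE !psi_mapE.
split; [exact: imsetS|exact: imsetS|move=> w; rewrite !leE !psi_mapE => xw yw].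
have repG' := psi_represents matG'.
have mem (u : psi_elt G') : psi_val u \in [set psi_val v | v in [set: psi_elt G']].
  exact: imset_f.
have [i ix] : exists i, i \in psi_val x.
  by apply/set0Pn; rewrite -card_gt0; apply: (rep_gt0 (psi_represents matG)).
have /imsetP[t _ tE] : s @: psi_val z :&: psi_val w \in [set psi_val v | v in [set: psi_elt G']].
  have := fam_inter (rep_family repG') (mem (psi_map z)) (mem w).
  rewrite psi_mapE; apply; apply/set0Pn; exists (s i); rewrite inE.
  by rewrite (subsetP xw) ?imset_f // (subsetP xz).
have [|u uz uE] := @psi_map_lift z t; first by rewrite -tE subsetIl.
have lift (v : psi_elt G) : psi_val v \subset psi_val z ->
    s @: psi_val v \subset psi_val w -> psi_val v \subset psi_val u.
  move=> vz vw; apply/subsetP=> a av.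
  have : s a \in s @: psi_val u.
    by rewrite uE -tE inE (subsetP vw) ?imset_f ?(subsetP vz).
  case/imsetP=> b bu sab; suff -> : a = b by [].
  by apply: (lphom_inj_psi (subsetP vz a av) (subsetP uz b bu) sab).
have /(imsetS s) : psi_val z \subset psi_val u by apply: zle; apply: lift.
by move/subset_trans; apply; rewrite uE -tE subsetIr.
Qed.

Definition psi_hom : rjhom (psi_poset G) (psi_poset G') := RJHom psi_map_rank_join.

End PsiMap.

Section OmegaMap.
Variables P P' : rposet.
Hypotheses (grP : graded P) (grP' : graded P').
Variable f : rjhom P P'.

Lemma omega_map_minimal (i : min_elt P) : minimal (f (min_val i)).
Proof.
have /rank_join_preservingP[_ frk _] := rjhomP f.
by rewrite graded_minimal // frk -graded_minimal // min_valP.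
Qed.

Definition omega_map : {ffun omega_graph grP -> omega_graph grP'} :=
  [ffun i : omega_graph grP => MinElt (omega_map_minimal i) : omega_graph grP'].

Lemma omega_mapE i : min_val (omega_map i) = f (min_val i).
Proof. by rewrite ffunE. Qed.

Lemma omega_map_label_preserving : label_preserving omega_map.
Proof.
have /rank_join_preservingP[_ frk fj] := rjhomP f.
apply/'forall_forallP => i j; apply/implyP => ijE.
have ij := edge_neq ijE; move: ijE; rewrite inE => /andP[_ /existsP[z sz]].
have sfz : sup_of [set omega_map i; omega_map j] (f z).
  by move: sz; rewrite !sup_of_pair !omega_mapE; apply: fj.
rewrite /= (omega_labelE sz) (omega_labelE sfz) frk eqxx andbT inE.
apply/andP; split; last by apply/existsP; exists (f z).
rewrite cards2; case: (eqVneq (omega_map i) (omega_map j)) => // E; move: sfz; rewrite E sup_of_pair.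
move: sz; rewrite sup_of_pair => /is_joinP[iz jz _] /is_joinP[_ _ fzle].
have fz1 : rk (f z) <= 1.
  have fzj := fzle _ (lexx _) (lexx _); have [rk_lt _ rk_min] := grP'.
  rewrite -(rk_min _ (min_valP (omega_map j))).
  by move: fzj; rewrite le_eqVlt => /predU1P[->|/rk_lt/ltnW].
have [rk_lt _ rk_min] := grP; move: iz jz; rewrite frk in fz1.
have eqz (k : min_elt P) : (min_val k <= z)%O -> min_val k = z.
  rewrite le_eqVlt => /predU1P[//|/rk_lt]; rewrite (rk_min _ (min_valP k)).
  by rewrite ltnNge fz1.
by move=> /eqz iz /eqz; rewrite -iz => /val_inj ji; rewrite ji eqxx in ij.
Qed.

Definition omega_hom : lphom (omega_graph grP) (omega_graph grP') :=
  LPHom omega_map_label_preserving.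

End OmegaMap.

Section OmegaPsi.
Variable G : elgraph.
Hypothesis matG : MAT_labeling G.
Hypothesis grG : graded (psi_poset G).
Local Notation OG := (omega_graph grG).

Lemma psi_singleton_minimal a (v : psi_poset G) : psi_val v = [set a] -> minimal v.
Proof. by move=> va; rewrite (rep_minimal (psi_represents matG)) va cards1. Qed.

Lemma singleton_psi (a : G) : psi_pred [set a].
Proof. by apply/orP; left; apply: imset_f. Qed.

Definition to_singleton (a : G) : OG :=
  MinElt (@psi_singleton_minimal a (PsiElt (singleton_psi a)) erefl).

Lemma minimal_psi (i : OG) : exists a, psi_val (min_val i) == [set a].
Proof.
have := min_valP i; rewrite (rep_minimal (psi_represents matG)) => /cards1P[a ->].
by exists a.
Qed.

Definition of_singleton (i : OG) : G := xchoose (minimal_psi i).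

Lemma of_singletonP (i : OG) : psi_val (min_val i) = [set of_singleton i].
Proof. exact/eqP/(xchooseP (minimal_psi i)). Qed.

Lemma to_singletonK : cancel to_singleton of_singleton.
Proof. by move=> a; apply/set1_inj; rewrite -of_singletonP. Qed.

Lemma of_singletonK : cancel of_singleton to_singleton.
Proof. by move=> i; do 2!apply/val_inj; rewrite /= -of_singletonP. Qed.

Lemma psi_sup_of a b (z : psi_poset G) : [set a; b] \in edges G ->
  psi_val z = principal_clique [set a; b] ->
  sup_of [set to_singleton a; to_singleton b] z.
Proof.
move=> abE zE; rewrite sup_of_pair; apply/is_joinP.
have leE (x y : psi_poset G) : (x <= y)%O = (psi_val x \subset psi_val y) by [].
have /sub2P[az bz] := edge_sub_clique [set a; b].
rewrite !leE /= !sub1set zE; split=> // w; rewrite !leE /= !sub1set zE => aw bw.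
by apply: principal_clique_least => //; apply/sub2P.
Qed.

Lemma to_singleton_edge a b : ([set to_singleton a; to_singleton b] \in edges OG) =
  ([set a; b] \in edges G).
Proof.
apply/idP/idP=> [/[dup]/edge_neq|abE].
  rewrite (can_eq to_singletonK) inE => ab /andP[_ /existsP[z]].
  rewrite sup_of_pair => /is_joinP[az bz _].
  have {}az : a \in psi_val z by rewrite -sub1set.
  have {}bz : b \in psi_val z by rewrite -sub1set.
  case/orP: (psi_valP z) => /imsetP[e eE zE]; rewrite zE in az bz.
    by move: az bz ab; rewrite !inE => /eqP-> /eqP->; rewrite eqxx.
  by have [] := principal_clique_pairs matG eE az bz ab.
have pz : psi_pred (principal_clique [set a; b]) by apply/orP; right; apply: imset_f.
rewrite inE cards2 (can_eq to_singletonK) (edge_neq abE) /=.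
by apply/existsP; exists (PsiElt pz); apply: psi_sup_of.
Qed.

Lemma to_singleton_label a b : [set a; b] \in edges G ->
  label ([set to_singleton a; to_singleton b] : {set OG}) = label [set a; b].
Proof.
move=> abE.
have pz : psi_pred (principal_clique [set a; b]) by apply/orP; right; apply: imset_f.
rewrite /= (omega_labelE (psi_sup_of (z := PsiElt pz) abE erefl)) /rk /=.
by rewrite card_principal_clique.
Qed.

Lemma to_singleton_label_preserving : label_preserving [ffun a => to_singleton a].
Proof.
apply/'forall_forallP => a b; apply/implyP => abE.
by rewrite !ffunE to_singleton_edge abE to_singleton_label //=.
Qed.

Lemma of_singleton_label_preserving : label_preserving [ffun i => of_singleton i].
Proof.
apply/'forall_forallP => i j; apply/implyP; rewrite !ffunE.
rewrite -[in X in X -> _](of_singletonK i) -[in X in X -> _](of_singletonK j).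
rewrite to_singleton_edge => ijE; rewrite ijE -(to_singleton_label ijE).
by rewrite !of_singletonK eqxx.
Qed.

End OmegaPsi.

Section PsiOmega.
Variable P : rposet.
Hypothesis LRP : LR_vine P.
Hypothesis grP : graded P.
Local Notation OP := (omega_graph grP).

Lemma minima_psi_pred (p : P) : psi_pred (minima p : {set OP}).
Proof.
have : minima p \in @minima P @: [set: P] by apply: imset_f.
by rewrite -(omega_psi_family LRP grP) => /imsetP[v _ ->]; apply: psi_valP.
Qed.

Definition to_minima (p : P) : psi_poset OP := PsiElt (minima_psi_pred p).

Lemma psi_omega_minima (v : psi_poset OP) : exists p, minima p == psi_val v.
Proof.
have : psi_val v \in [set psi_val v | v in [set: psi_elt OP]] by apply: imset_f.
by rewrite (omega_psi_family LRP grP) => /imsetP[p _ ->]; exists p.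
Qed.

Definition of_minima (v : psi_poset OP) : P := xchoose (psi_omega_minima v).

Lemma of_minimaP v : minima (of_minima v) = psi_val v.
Proof. exact/eqP/(xchooseP (psi_omega_minima v)). Qed.

Lemma to_minimaK : cancel to_minima of_minima.
Proof. by move=> p; apply: (minima_inj LRP); rewrite of_minimaP. Qed.

Lemma of_minimaK : cancel of_minima to_minima.
Proof. by move=> v; apply/val_inj; rewrite /= of_minimaP. Qed.

Lemma to_minima_rank_join : rank_join_preserving [ffun p => to_minima p].
Proof.
apply: iso_rank_join_preserving => [x y|v|x].
- by rewrite !ffunE (minima_le LRP).
- by exists (of_minima v); rewrite ffunE of_minimaK.
- by rewrite ffunE -(card_minima LRP).
Qed.

Lemma of_minima_rank_join : rank_join_preserving [ffun v => of_minima v].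
Proof.
apply: iso_rank_join_preserving => [x y|p|x].
- by rewrite !ffunE (minima_le LRP) !of_minimaP.
- by exists (to_minima p); rewrite ffunE to_minimaK.
- by rewrite ffunE -(card_minima LRP) of_minimaP.
Qed.

End PsiOmega.

Lemma minima_rjhom (P P' : rposet) (LRP : LR_vine P) (LRP' : LR_vine P')
    (grP : graded P) (grP' : graded P') (f : rjhom P P') (p : P) :
  minima (f p) = omega_hom grP grP' f @: minima p.
Proof.
have /rank_join_preservingP[fle frk fj] := rjhomP f.
apply/esym/eqP; rewrite eqEcard; apply/andP; split.
  apply/subsetP=> _ /imsetP[i + ->]; rewrite !inE /= omega_mapE.
  exact: fle.
rewrite card_in_imset ?card_minima ?frk // => i j ip jp fij.
apply/eqP; apply: contraT => ij.
have lrF := rep_family (minima_represents LRP).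
have pF : minima p \in @minima P @: [set: P] by apply: imset_f.
have sijp : [set i; j] \subset minima p by apply/sub2P.
have ij0 : [set i; j] != set0 by apply/set0Pn; exists i; rewrite set21.
have [w L] := fam_least lrF pF sijp ij0; have /leastP[/imsetP[z _ wz] _ _] := L.
rewrite wz in L.
have ijE : ([set i; j] : {set omega_graph grP}) \in edges (omega_graph grP).
  by apply/(omega_edgeP LRP); split; [rewrite cards2 ij | exists z].
have [/edge_neq] := lphom_edge (omega_hom grP grP' f) ijE.
by rewrite fij eqxx.
Qed.

Definition psi_LR_vine (G : MATgraph) : LR_vine (psi_poset G) :=
  rep_LR_vine (psi_represents (MATgraphP G)).

Definition psi_fmap (G G' : MATgraph) (s : lphom G G') :
    rjhom (psi_poset G) (psi_poset G') :=
  psi_hom (MATgraphP G) (MATgraphP G') s.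

Lemma psi_fmapE (G G' : MATgraph) (s : lphom G G') (v : psi_elt G) :
  psi_val (psi_fmap s v) = s @: psi_val v.
Proof. exact: psi_mapE. Qed.

Lemma psi_fmap_id (G : MATgraph) : psi_fmap (lphom_id G) = rjhom_id (psi_poset G).
Proof.
apply/val_inj/ffunP=> v; apply/val_inj; rewrite /= psi_fmapE ffunE.
by rewrite -[RHS]imset_id; apply: eq_imset => a; rewrite ffunE.
Qed.

Lemma psi_fmap_comp (G1 G2 G3 : MATgraph) (t : lphom G2 G3) (s : lphom G1 G2) :
  psi_fmap (lphom_comp t s) = rjhom_comp (psi_fmap t) (psi_fmap s).
Proof.
apply/val_inj/ffunP=> v; apply/val_inj; rewrite /= [in RHS]ffunE !psi_fmapE.
by rewrite -imset_comp; apply: eq_imset => a; rewrite ffunE.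
Qed.

Definition Psi : @functor_on MG LRV (fun G : MATgraph => LRVine (psi_LR_vine G)) :=
  @FunctorOn MG LRV (fun G : MATgraph => LRVine (psi_LR_vine G))
    psi_fmap psi_fmap_id psi_fmap_comp.

Definition omega_MAT_labeling (P : LRvine) :
    MAT_labeling (omega_graph (LRvine_graded P)) :=
  omega_MAT (LRvineP P) (LRvine_graded P).

Definition omega_fmap (P P' : LRvine) (f : rjhom P P') :
    lphom (omega_graph (LRvine_graded P)) (omega_graph (LRvine_graded P')) :=
  omega_hom (LRvine_graded P) (LRvine_graded P') f.

Lemma omega_fmapE (P P' : LRvine) (f : rjhom P P') (i : min_elt P) :
  min_val (omega_fmap f i) = f (min_val i).
Proof. exact: omega_mapE. Qed.

Lemma omega_fmap_id (P : LRvine) : omega_fmap (rjhom_id P) = lphom_id _.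
Proof.
by apply/val_inj/ffunP=> i; apply/val_inj; rewrite /= omega_fmapE !ffunE.
Qed.

Lemma omega_fmap_comp (P1 P2 P3 : LRvine) (g : rjhom P2 P3) (f : rjhom P1 P2) :
  omega_fmap (rjhom_comp g f) = lphom_comp (omega_fmap g) (omega_fmap f).
Proof.
apply/val_inj/ffunP=> i; apply/val_inj.
by rewrite /= [in RHS]ffunE !omega_fmapE ffunE.
Qed.

Definition Omega :
    @functor_on LRV MG (fun P : LRvine => MATGraph (omega_MAT_labeling P)) :=
  @FunctorOn LRV MG (fun P : LRvine => MATGraph (omega_MAT_labeling P))
    omega_fmap omega_fmap_id omega_fmap_comp.

Lemma PsiOmega_iso :
  naturally_isomorphic (functor_comp (Functor Psi) (Functor Omega)) (functor_id LRV).
Proof.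
exists (fun P : LRvine => RJHom (of_minima_rank_join (LRvineP P) (LRvine_graded P))).
split=> [P P' f|P].
  apply/val_inj/ffunP=> v; apply: (minima_inj (LRvineP P')).
  rewrite /= ffunE [in RHS]ffunE !ffunE of_minimaP.
  rewrite (minima_rjhom (LRvineP P) (LRvineP P') (LRvine_graded P) (LRvine_graded P')).
  by rewrite of_minimaP.
exists (RJHom (to_minima_rank_join (LRvineP P) (LRvine_graded P))).
split; apply/val_inj/ffunP=> v; rewrite /= !ffunE.
  exact: of_minimaK.
exact: to_minimaK.
Qed.

Lemma OmegaPsi_iso :
  naturally_isomorphic (functor_comp (Functor Omega) (Functor Psi)) (functor_id MG).
Proof.
exists (fun G : MATgraph => LPHom (of_singleton_label_preserving (MATgraphP G)
  (LRvine_graded (LRVine (psi_LR_vine G))))).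
split=> [G G' s|G].
  apply/val_inj/ffunP=> i; rewrite /= !ffunE.
  apply/set1_inj; rewrite -of_singletonP /= ffunE /=.
  rewrite !ffunE; set a := of_singleton _ _.
  have -> : psi_val (min_val i) = [set a] by apply: of_singletonP.
  exact: imset_set1.
exists (LPHom (to_singleton_label_preserving (MATgraphP G)
  (LRvine_graded (LRVine (psi_LR_vine G))))).
split; apply/val_inj/ffunP=> i; rewrite /= !ffunE.
  exact: of_singletonK.
exact: to_singletonK.
Qed.

Theorem theorem6p10 :
  exists (PsiP : forall G : MATgraph, LR_vine (psi_poset G))
         (OmegaP : forall P : LRvine,
            MAT_labeling (omega_graph (LRvine_graded P)))
         (Psi : @functor_on MG LRV (fun G : MATgraph => LRVine (PsiP G)))
         (Omega : @functor_on LRV MG (fun P : LRvine => MATGraph (OmegaP P))),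
    (forall (G G' : MATgraph) (s : lphom G G') (v : psi_elt G),
       psi_val ((fmap Psi s : rjhom (psi_poset G) (psi_poset G')) v)
       = [set s a | a in psi_val v])
    /\ (forall (P P' : LRvine) (f : rjhom P P') (i : min_elt P),
       min_val ((fmap Omega f : lphom (omega_graph (LRvine_graded P))
                                      (omega_graph (LRvine_graded P'))) i)
       = f (min_val i))
    /\ naturally_isomorphic (functor_comp (Functor Psi) (Functor Omega))
                            (functor_id LRV)
    /\ naturally_isomorphic (functor_comp (Functor Omega) (Functor Psi))
                            (functor_id MG)
    /\ equivalent_categories MG LRV.
Proof.
exists psi_LR_vine, omega_MAT_labeling, Psi, Omega.
split; first exact: psi_fmapE.
split; first exact: omega_fmapE.
split; first exact: PsiOmega_iso.
split; first exact: OmegaPsi_iso.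
by exists (Functor Psi), (Functor Omega); split; [apply: PsiOmega_iso | apply: OmegaPsi_iso].
Qed.
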